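(* Let $1\le p<\infty$, $1\le q<\infty$, $n\ge 1$ and $s\in\mathbb{R}$. Then the inequality $$\left\|\sup_{0<t<1}\left|e^{it\Delta} f\right|\right\|_{L^{q,\infty}(B(0,1))}\le C\, \|f\|_{L_s^p (\mathbb R^n)}$$ does not hold for all $f\in L_s^p(\mathbb{R}^n)$ with any finite constant $C$ independent of $f$, in each of the following cases: (1) $n=1$ and $s<\frac{1}{2p}$; (2) $n\geq 2$, $1\leq p<2$ and $s<n\left(\frac1p-\frac12\right)$; (3) $n\geq 2$, $2\leq p< \frac{2n-1}{n-1}$ and $s<\left(\frac12-n\right)\left(\frac12-\frac1p\right)+\frac14$.
   Context: Fourier transform conventions: $\widehat f(\xi)=\int_{\mathbb{R}^n}e^{-ix\cdot\xi}f(x)\,dx$ and $f^\vee(x)=(2\pi)^{-n}\int_{\mathbb{R}^n}e^{ix\cdot\xi}f(\xi)\,d\xi$, extended to tempered distributions. Bessel potential space: for $s\in\mathbb{R}$ and $1\le p\le\infty$, $L^p_s(\mathbb{R}^n)$ is the space of tempered distributions $f$ with $((1+|\xi|^2)^{s/2}\widehat f)^\vee\in L^p(\mathbb{R}^n)$, with norm $\|f\|_{L^p_s(\mathbb{R}^n)}=\|((1+|\cdot|^2)^{s/2}\widehat f)^\vee\|_{L^p(\mathbb{R}^n)}$. Schrödinger operator: $e^{it\Delta}f(x)=(2\pi)^{-n}\int_{\mathbb{R}^n}e^{ix\cdot\xi-it|\xi|^2}\widehat f(\xi)\,d\xi$. For Schwartz functions $f$ this integral converges absolutely. An estimate for all $f\in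 L^p_s(\mathbb{R}^n)$ with $1\le p<\infty$ is understood in the usual way as the estimate, with uniform constant, for all Schwartz functions $f$ on $\mathbb{R}^n$ (dense in $L^p_s(\mathbb{R}^n)$), then extended by density. $B(0,1)$ is the open unit ball of $\mathbb{R}^n$ centered at the origin, and $\|g\|_{L^{q,\infty}(B(0,1))}=\sup_{\alpha>0}\alpha\,|\{x\in B(0,1):|g(x)|>\alpha\}|^{1/q}$. *)

(* Defs.v *)
From HB Require Import structures.
From mathcomp Require Import all_boot all_order all_algebra.
From mathcomp Require Import all_classical all_reals all_analysis.
From mathcomp.real_closed Require Export complex.

Set Implicit Arguments.
Unset Strict Implicit.
Unset Printing Implicit Defensive.

Import Order.TTheory GRing.Theory Num.Theory.
Import numFieldNormedType.Exports.
Import ComplexField.Normc.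

Local Open Scope classical_set_scope.
Local Open Scope ring_scope.

(* 'rV[R]_n carries the product sigma-algebra, as n.-tuple does in the library;
   it is the Borel sigma-algebra of R^n. *)
Section measurable_row.
Context {R : realType} (n : nat).

Definition row_coord (i : 'I_n) (v : 'rV[R]_n) : measurableTypeR R := v ord0 i.

Let row_set0 : g_sigma_preimage row_coord set0.
Proof. exact: sigma_algebra0. Qed.

Let row_setC A : g_sigma_preimage row_coord A ->
  g_sigma_preimage row_coord (~` A).
Proof. exact: sigma_algebraC. Qed.

Let row_bigcup (F : _^nat) : (forall i, g_sigma_preimage row_coord (F i)) ->
  g_sigma_preimage row_coord (\bigcup_i (F i)).
Proof. exact: sigma_algebra_bigcup. Qed.

HB.instance Definition _ :=
  @isMeasurable.Build (measure_tuple_display default_measure_display) 'rV[R]_n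
    (g_sigma_preimage row_coord) row_set0 row_setC row_bigcup.

End measurable_row.

Lemma measurable_fun_row d (T : measurableType d) (R : realType) n
    (f : T -> 'rV[R]_n) :
  (forall i, measurable_fun [set: T] (@row_coord R n i \o f)) ->
  measurable_fun [set: T] f.
Proof.
move=> mf; have H : g_sigma_preimage (fun i => @row_coord R n i \o f)
    `<=` measurable.
  apply: smallest_sub; first exact: sigma_algebra_measurable.
  case: n => [|n] in f mf *; first by rewrite big_ord0.
  rewrite -bigcup_mkord_ord; apply: bigcup_sub => i Ii.
  by move=> A [B mB <-]; exact: mf.
move=> _ A mA; apply: H; rewrite g_sigma_preimage_comp.
by exists A.
Qed.

Lemma measurable_row_coord (R : realType) n (i : 'I_n) :
  measurable_fun [set: 'rV[R]_n] (@row_coord R n i).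
Proof.
move=> _ Y mY; rewrite setTI; apply: sub_sigma_algebra => /=.
rewrite -bigcup_seq/=; exists i => /=; first by rewrite mem_index_enum.
by exists Y => //; rewrite setTI.
Qed.

Section row_cons.
Context {R : realType} (n : nat).

Definition row_cons (p : measurableTypeR R * 'rV[R]_n) : 'rV[R]_n.+1 :=
  row_mx (const_mx p.1 : 'rV[R]_1) p.2.

Lemma row_cons0 p : row_cons p ord0 ord0 = p.1.
Proof.
rewrite /row_cons (_ : ord0 = @lshift 1 n ord0); last exact/val_inj.
by rewrite (@row_mxEl _ 1 1 n) mxE.
Qed.

Lemma row_consS p i : row_cons p ord0 (lift ord0 i) = p.2 ord0 i.
Proof.
rewrite /row_cons (_ : lift ord0 i = @rshift 1 n i); last exact/val_inj.
by rewrite (@row_mxEr _ 1 1 n).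
Qed.

Lemma measurable_row_cons : measurable_fun [set: _] row_cons.
Proof.
apply: measurable_fun_row => i; have [j ->|->] := unliftP ord0 i.
  rewrite (_ : _ \o _ = @row_coord R n j \o snd).
    by apply: measurableT_comp => //; exact: measurable_row_coord.
  by apply/funext => p; exact: row_consS.
rewrite (_ : _ \o _ = fst) //; apply/funext => p; exact: row_cons0.
Qed.

Variable mu : {sigma_finite_measure set 'rV[R]_n -> \bar R}.

Definition lebesgue_row_cons : set 'rV[R]_n.+1 -> \bar R :=
  pushforward (lebesgue_measure \x mu)%E row_cons.

Let lebesgue_row_cons0 : lebesgue_row_cons set0 = 0%E.
Proof. by rewrite /lebesgue_row_cons /pushforward preimage_set0 measure0. Qed.

Let lebesgue_row_cons_ge0 A : (0 <= lebesgue_row_cons A)%E.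
Proof. by rewrite /lebesgue_row_cons /pushforward. Qed.

Let lebesgue_row_cons_sigma_additive : semi_sigma_additive lebesgue_row_cons.
Proof.
pose mprod : {measure set _ -> \bar R} := (lebesgue_measure \x mu)%E.
exact: (@measure_semi_sigma_additive _ _ _
  (measure_function_pushforward__canonical__measure_function_Measure mprod
    measurable_row_cons)).
Qed.

HB.instance Definition _ := isMeasure.Build _ _ _ lebesgue_row_cons
  lebesgue_row_cons0 lebesgue_row_cons_ge0 lebesgue_row_cons_sigma_additive.

Let sigma_finite_row_cons : sigma_finite setT lebesgue_row_cons.
Proof.
have /sigma_finiteP[F [TF ndF Foo]] :=
  sigma_finiteT (@lebesgue_measure R : {sigma_finite_measure set _ -> \bar R}).
have /sigma_finiteP[G [TG ndG Goo]] := sigma_finiteT mu.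
pose row_uncons (v : 'rV[R]_n.+1) : measurableTypeR R * 'rV[R]_n :=
  (row_coord ord0 v, @rsubmx R 1 1 n v).
have uncons1 : cancel row_cons row_uncons.
  move=> [x v]; rewrite /row_uncons /row_coord /=; congr pair.
    exact: (row_cons0 (x, v)).
  exact: (@row_mxKr _ 1 1 n).
have muncons : measurable_fun [set: _] row_uncons.
  apply/measurable_fun_pairP; split.
    exact: measurable_row_coord.
  apply: measurable_fun_row => i.
  rewrite (_ : _ \o _ = @row_coord R n.+1 (@rshift 1 n i)).
    exact: measurable_row_coord.
  by apply/funext => v; rewrite /row_coord /= mxE.
exists (fun k => row_uncons @^-1` (F k `*` G k)).
  rewrite -preimage_bigcup -[LHS](preimage_setT row_uncons); congr (_ @^-1` _).
  rewrite -setXTT TF TG predeqE => -[x y]; split.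
    move=> [/= [k _ Fkx] [l _ Gly]]; exists (maxn k l) => //; split.
    - by move: x Fkx; exact/subsetPset/ndF/leq_maxl.
    - by move: y Gly; exact/subsetPset/ndG/leq_maxr.
  by move=> [k _ []/= ? ?]; split; exists k.
move=> k; have [mF Fk] := Foo k; have [mG Gk] := Goo k; split.
  by rewrite -[X in measurable X]setTI; apply: muncons => //; exact: measurableX.
rewrite /lebesgue_row_cons /pushforward -comp_preimage.
rewrite (_ : _ \o _ = id); last by apply/funext => p /=; rewrite uncons1.
by rewrite preimage_id product_measure1E// lte_mul_pinfty// ge0_fin_numE.
Qed.

HB.instance Definition _ :=
  Measure_isSigmaFinite.Build _ _ _ lebesgue_row_cons sigma_finite_row_cons.

End row_cons.

Fixpoint lebesgue_row (R : realType) (n : nat) :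
    {sigma_finite_measure set 'rV[R]_n -> \bar R} :=
  if n is m.+1 then lebesgue_row_cons (lebesgue_row R m) else \d_(0 : 'rV[R]_0).

Lemma lebesgue_row_box (R : realType) n (A : 'I_n -> set (measurableTypeR R)) :
  (forall i, measurable (A i)) ->
  lebesgue_row R n [set v | forall i, A i (v ord0 i)] =
  (\prod_(i < n) lebesgue_measure (A i))%E.
Proof.
elim: n => [|n IHn] in A * => mA.
  by rewrite big_ord0 /= diracE mem_set// => -[].
have mB : measurable [set v : 'rV[R]_n | forall i, A (lift ord0 i) (v ord0 i)].
  rewrite (_ : [set _ | _] = \bigcap_(i in [set: 'I_n])
      (@row_coord R n i @^-1` A (lift ord0 i))).
    apply: fin_bigcap_measurable => // i _.
    by rewrite -[X in measurable X]setTI; exact: measurable_row_coord.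
  by apply/seteqP; split=> v /= Av; [move=> i _|move=> i]; exact: Av.
rewrite big_ord_recl -(IHn (fun i => A (lift ord0 i)))//.
rewrite -(product_measure1E _ _ (mA ord0) mB) /= /lebesgue_row_cons /pushforward.
congr (_ _); apply/seteqP; split=> [[x v] Axv|[x v] [Ax Av] i] /=.
  split => [|i]; first by have := Axv ord0; rewrite row_cons0.
  by have := Axv (lift ord0 i); rewrite row_consS.
by have [j ->|->] := unliftP ord0 i; rewrite ?row_consS ?row_cons0//; exact: Av.
Qed.

Section schwartz.
Context {R : realType} {n : nat}.
Implicit Types (u : 'rV[R]_n -> R) (f : 'rV[R]_n -> R[i]).

(* [:: i1; ...; ik] |-> d_i1 ... d_ik u; every multi-index derivative is of
   this form. *)
Definition partials (b : seq 'I_n) u : 'rV[R]_n -> R :=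
  foldr (fun i g x => 'D_(delta_mx ord0 i) g x) u b.

Definition smooth u := forall b : seq 'I_n,
  continuous (partials b u) /\
  forall i x, derivable (partials b u) x (delta_mx ord0 i).

Definition real_schwartz u := smooth u /\
  forall (a : 'I_n -> nat) (b : seq 'I_n), exists M : R,
    forall x : 'rV[R]_n,
      `|(\prod_(i < n) x ord0 i ^+ a i) * partials b u x| <= M.

Definition schwartz f :=
  real_schwartz (fun x => complex.Re (f x)) /\
  real_schwartz (fun x => complex.Im (f x)).

End schwartz.

Section fourier.
Context {R : realType} {n : nat}.
Implicit Types (f g : 'rV[R]_n -> R[i]) (x xi : 'rV[R]_n) (t s : R).

Definition dot x xi : R := \sum_(i < n) x ord0 i * xi ord0 i.

(* The library norm on 'rV[R]_n is the sup norm. *)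
Definition enorm x : R := Num.sqrt (dot x x).

Definition unit_ball : set 'rV[R]_n := [set x | enorm x < 1].

Definition expi (a : R) : R[i] := (cos a +i* sin a)%C.

(* Rintegral returns 0 when the integral is infinite or undefined; on Schwartz
   functions every integral below converges absolutely. *)
Definition cintegral f : R[i] :=
  (Rintegral (lebesgue_row R n) setT (fun x => complex.Re (f x)) +i*
   Rintegral (lebesgue_row R n) setT (fun x => complex.Im (f x)))%C.

Definition fourier f xi : R[i] :=
  cintegral (fun x => expi (- dot x xi) * f x).

Definition inv_fourier g x : R[i] :=
  (((2 * pi) ^- n)%:C)%C * cintegral (fun xi => expi (dot x xi) * g xi).

Definition schrodinger t f x : R[i] :=
  (((2 * pi) ^- n)%:C)%C *
  cintegral (fun xi => expi (dot x xi - t * enorm xi ^+ 2) * fourier f xi).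

(* For Schwartz f the product below is again Schwartz, so this absolutely
   convergent integral is the distributional ((1 + |.|^2)^(s/2) f^)^v. *)
Definition bessel s f : 'rV[R]_n -> R[i] :=
  inv_fourier (fun xi =>
    (((1 + enorm xi ^+ 2) `^ (s / 2))%:C)%C * fourier f xi).

Definition sobolev_norm (p s : R) f : \bar R :=
  Lnorm (lebesgue_row R n) p%:E (fun x => (normc (bessel s f x))%:E).

Definition schrodinger_maximal f x : \bar R :=
  ereal_sup [set (normc (schrodinger t f x))%:E | t in `]0, 1[%classic].

Definition weak_Lnorm (q : R) (A : set 'rV[R]_n) (g : 'rV[R]_n -> \bar R)
    : \bar R :=
  ereal_sup [set (a%:E *
      lebesgue_row R n [set x | A x /\ a%:E < `|g x|] `^ (q^-1))%E
    | a in [set a : R | 0 < a]].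

End fourier.

(* Main.v *)
(* With n = m + 1, each of the three cases implies
   delta := (2 m + 1) / (2 p) - m / 2 - s > 0, and one family of Gaussian wave
   packets then violates the estimate: f_N has frequency N and width N^(-1/2) in
   x_0, and frequency 0 and width 1/N in each other variable. At the
   time t = x_0 / (2 N) the packet is centred above x_0 and has spread to unit
   width in the remaining variables, so the maximal function is at least
   c N^(-m/2) on a fixed box in the unit ball. On the other side f_N lives at
   frequencies |xi| ~ N, so its Sobolev norm is at most C N^s ||f_N||_p, that is
   C N^(s - (2 m + 1) / (2 p)), and N^delta would have to stay bounded. For the
   upper bound, (1 + |xi|^2)^(s/2) is written as a polynomial times a Gamma
   integral of heat kernels exp(-u (1 + |xi|^2)), each of which acts explicitly
   and coordinatewise on the packet. *)
Require Import Defs.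
From mathcomp Require Import all_boot all_order all_algebra.
From mathcomp Require Import all_classical all_reals all_analysis.
From mathcomp Require Import measurable_realfun.
From mathcomp Require Import ring lra.

Set Implicit Arguments.
Unset Strict Implicit.
Unset Printing Implicit Defensive.

Import Order.TTheory GRing.Theory Num.Theory.
Import numFieldNormedType.Exports.
Import ComplexField.Normc.

Local Open Scope classical_set_scope.
Local Open Scope ring_scope.


(** The obstacle is that s may be any real number: the multiplier (1 + |xi|^2)^(s/2) is not a
    product over the coordinates, and for s < 0 the packet, whose transform has no zero, must still
    gain the full N^s. Heat kernels are products over the coordinates. At heat time u the damping of
    the oscillating coordinate is exp(-u N^2 / (1 + 2 u N)), which stops improving once u exceeds
    1/N; for large u the factor exp(-u) coming from the constant 1 in the symbol has to provide the
    decay. The scaling w = u N^2 then yields N^s with a constant free of N.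

    Every one-dimensional integral is a moment of exp(i (y x - t x^2) - x^2). No contour is used:
    integration by parts gives linear recurrences between the moments, and these give a differential
    equation along the rays (r y, r t). For the Schrodinger evolution only the modulus is needed.
    For the heat flow t = 0, and decay like 1 / (1 + y^2) suffices, so the Sobolev estimate runs on
    rational weights instead of Gaussians. *)

Section complex_arith.
Context {R : realType}.
Implicit Types (z w : R[i]) (a b : R).

Lemma ReD z w : complex.Re (z + w) = complex.Re z + complex.Re w.
Proof. by case: z => a b; case: w => c d. Qed.

Lemma ImD z w : complex.Im (z + w) = complex.Im z + complex.Im w.
Proof. by case: z => a b; case: w => c d. Qed.

Lemma ReM z w : complex.Re (z * w) =
  complex.Re z * complex.Re w - complex.Im z * complex.Im w.
Proof. by case: z => a b; case: w => c d. Qed.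

Lemma ImM z w : complex.Im (z * w) =
  complex.Re z * complex.Im w + complex.Im z * complex.Re w.
Proof. by case: z => a b; case: w => c d /=. Qed.

Lemma complex_ext z w : complex.Re z = complex.Re w ->
  complex.Im z = complex.Im w -> z = w.
Proof. by case: z => a b; case: w => c d /= -> ->. Qed.

Lemma normc_ge0 z : 0 <= normc z.
Proof. by case: z => a b; exact: sqrtr_ge0. Qed.

Lemma norm_Re_le z : `|complex.Re z| <= normc z.
Proof.
case: z => a b /=; rewrite -(ler_pXn2r (ltn0Sn 1)) ?nnegrE ?sqrtr_ge0//.
by rewrite sqr_sqrtr ?addr_ge0 ?sqr_ge0// real_normK ?num_real// lerDl sqr_ge0.
Qed.

Lemma norm_Im_le z : `|complex.Im z| <= normc z.
Proof.
case: z => a b /=; rewrite -(ler_pXn2r (ltn0Sn 1)) ?nnegrE ?sqrtr_ge0//.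
by rewrite sqr_sqrtr ?addr_ge0 ?sqr_ge0// real_normK ?num_real// lerDr sqr_ge0.
Qed.

Lemma normc_le_ReIm z : normc z <= `|complex.Re z| + `|complex.Im z|.
Proof.
case: z => a b /=; rewrite -(ler_pXn2r (ltn0Sn 1)) ?nnegrE ?sqrtr_ge0 ?addr_ge0//.
rewrite sqr_sqrtr ?addr_ge0 ?sqr_ge0// sqrrD !real_normK ?num_real//.
by rewrite lerD2r lerDl mulrn_wge0// mulr_ge0.
Qed.

Lemma normc_real a : normc (a%:C)%C = `|a|.
Proof. by rewrite /normc/= expr0n/= addr0 sqrtr_sqr. Qed.

Lemma normc_prod (I : finType) (z : I -> R[i]) :
  normc (\prod_i z i) = \prod_i normc (z i).
Proof.
exact: (big_morph (@normc R) (@normcM R) (@normc1 R)).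
Qed.

Lemma real_complexM a b : ((a * b)%:C = a%:C * b%:C)%C.
Proof. by apply: complex_ext; rewrite ?ReM ?ImM/=; ring. Qed.

Lemma real_complexD a b : ((a + b)%:C = a%:C + b%:C)%C.
Proof. by apply: complex_ext; rewrite ?ReD ?ImD/=; ring. Qed.

Lemma real_complex_prod (I : finType) (a : I -> R) :
  ((\prod_i a i)%:C = \prod_i (a i)%:C)%C.
Proof.
by apply: (big_morph (fun a => a%:C)%C); first exact: real_complexM.
Qed.

Lemma expi0 : expi (0 : R) = 1.
Proof. by rewrite /expi cos0 sin0. Qed.

Lemma expiD a b : expi (a + b) = expi a * expi b.
Proof.
by apply: complex_ext; rewrite ?ReM ?ImM/= ?cosD ?sinD; ring.
Qed.

Lemma expi_sum (I : finType) (a : I -> R) :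
  expi (\sum_i a i) = \prod_i expi (a i).
Proof.
by apply: (big_morph expi); [exact: expiD|exact: expi0].
Qed.

Lemma normc_expi a : normc (expi a) = 1.
Proof. by rewrite /normc/= cos2Dsin2 sqrtr1. Qed.

End complex_arith.

(** * Integrals of complex-valued functions, by real and imaginary parts *)

Section complex_integral.
Context d (T : measurableType d) (R : realType).
Variable mu : {measure set T -> \bar R}.
Implicit Types (f g : T -> R[i]) (a : T -> R) (c : R[i]).

(** Over [lebesgue_row R n] this is convertible to [cintegral]. The measure is a parameter because
    Fubini needs the same notion on the line, on rows and on products. *)
Definition cint f : R[i] :=
  (Rintegral mu setT (fun x => complex.Re (f x)) +i*
   Rintegral mu setT (fun x => complex.Im (f x)))%C.

Definition cmeasurable f :=
  measurable_fun [set: T] (fun x => complex.Re (f x)) /\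
  measurable_fun [set: T] (fun x => complex.Im (f x)).

Definition cintegrable f :=
  mu.-integrable setT (EFin \o (fun x => complex.Re (f x))) /\
  mu.-integrable setT (EFin \o (fun x => complex.Im (f x))).

Lemma integrable_measurable a :
  mu.-integrable setT (EFin \o a) -> measurable_fun setT a.
Proof. by move=> /measurable_int/measurable_EFinP. Qed.

Lemma integrableDr a b : mu.-integrable setT (EFin \o a) ->
  mu.-integrable setT (EFin \o b) ->
  mu.-integrable setT (EFin \o (fun x => a x + b x)).
Proof. by move=> ia ib; have := integrableD measurableT ia ib. Qed.

Lemma integrableBr a b : mu.-integrable setT (EFin \o a) ->
  mu.-integrable setT (EFin \o b) ->
  mu.-integrable setT (EFin \o (fun x => a x - b x)).
Proof. by move=> ia ib; have := integrableB measurableT ia ib. Qed.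

Lemma integrable_mull (r : R) a : mu.-integrable setT (EFin \o a) ->
  mu.-integrable setT (EFin \o (fun x => r * a x)).
Proof. by move=> ia; have := integrableZl measurableT r ia. Qed.

Lemma integrable_le a b : measurable_fun setT a ->
  (forall x, `|a x| <= b x) -> mu.-integrable setT (EFin \o b) ->
  mu.-integrable setT (EFin \o a).
Proof.
move=> ma ab; apply: le_integrable => //; first exact/measurable_EFinP.
by move=> x _ /=; rewrite lee_fin (le_trans (ab x))// ler_norm.
Qed.

Lemma cmeasurable_real a : measurable_fun setT a ->
  cmeasurable (fun x => (a x)%:C)%C.
Proof. by move=> ma; split => //=; exact: measurable_cst. Qed.

Lemma cmeasurable_expi a : measurable_fun setT a ->
  cmeasurable (fun x => expi (a x)).
Proof.
by move=> ma; split => /=; apply: measurableT_comp => //;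
  apply: continuous_measurable_fun; [exact: continuous_cos|exact: continuous_sin].
Qed.

Lemma cmeasurableM f g : cmeasurable f -> cmeasurable g ->
  cmeasurable (fun x => f x * g x).
Proof.
move=> [f1 f2] [g1 g2]; split.
  under eq_fun do rewrite ReM.
  by apply: measurable_funB; exact: measurable_funM.
under eq_fun do rewrite ImM.
by apply: measurable_funD; exact: measurable_funM.
Qed.

Lemma cintegrable_cmeasurable f : cintegrable f -> cmeasurable f.
Proof. by move=> [? ?]; split; exact: integrable_measurable. Qed.

Lemma cintegrable_le f a : cmeasurable f ->
  (forall x, normc (f x) <= a x) -> mu.-integrable setT (EFin \o a) ->
  cintegrable f.
Proof.
move=> [mf1 mf2] fa ia; split; apply: integrable_le ia => // x.
  exact: le_trans (norm_Re_le _) (fa x).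
exact: le_trans (norm_Im_le _) (fa x).
Qed.

Lemma cintD f g : cintegrable f -> cintegrable g ->
  cint (fun x => f x + g x) = cint f + cint g.
Proof.
move=> [f1 f2] [g1 g2]; apply: complex_ext; rewrite ?ReD ?ImD/=.
  by rewrite -RintegralD//; apply: eq_Rintegral => x _; rewrite ReD.
by rewrite -RintegralD//; apply: eq_Rintegral => x _; rewrite ImD.
Qed.

Lemma cintegrableD f g : cintegrable f -> cintegrable g ->
  cintegrable (fun x => f x + g x).
Proof.
move=> [f1 f2] [g1 g2]; split.
  by under eq_fun do rewrite ReD; exact: integrableDr.
by under eq_fun do rewrite ImD; exact: integrableDr.
Qed.

Lemma cintegrableZ c f : cintegrable f -> cintegrable (fun x => c * f x).
Proof.
move=> [f1 f2]; split.
  by under eq_fun do rewrite ReM; apply: integrableBr; exact: integrable_mull.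
by under eq_fun do rewrite ImM; apply: integrableDr; exact: integrable_mull.
Qed.

Lemma cintZ c f : cintegrable f -> cint (fun x => c * f x) = c * cint f.
Proof.
move=> [f1 f2]; apply: complex_ext; rewrite ?ReM ?ImM/=.
  rewrite -!RintegralZl// -RintegralB//; last 2 first.
  - exact: integrable_mull.
  - exact: integrable_mull.
  by apply: eq_Rintegral => x _; rewrite ReM.
rewrite -!RintegralZl// -RintegralD//; last 2 first.
- exact: integrable_mull.
- exact: integrable_mull.
by apply: eq_Rintegral => x _; rewrite ImM.
Qed.

Lemma eq_cint f g : f =1 g -> cint f = cint g.
Proof. by move=> /funext ->. Qed.

Lemma cint0 : cint (fun=> 0) = 0.
Proof. by rewrite /cint/= Rintegral_cst// mul0r. Qed.

Lemma cintegrable0 : cintegrable (fun=> 0).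
Proof. by split; exact: (integrable0 mu setT). Qed.

Lemma cintegrable_sum (I : Type) (s : seq I) (F : I -> T -> R[i]) :
  (forall i, cintegrable (F i)) -> cintegrable (fun x => \sum_(i <- s) F i x).
Proof.
move=> iF; elim: s => [|i s IHs].
  by under eq_fun do rewrite big_nil; exact: cintegrable0.
by under eq_fun do rewrite big_cons; exact: cintegrableD.
Qed.

Lemma cint_sum (I : Type) (s : seq I) (F : I -> T -> R[i]) :
  (forall i, cintegrable (F i)) ->
  cint (fun x => \sum_(i <- s) F i x) = \sum_(i <- s) cint (F i).
Proof.
move=> iF; elim: s => [|i s IHs].
  by rewrite big_nil -[RHS]cint0; apply: eq_cint => x; rewrite big_nil.
rewrite big_cons -IHs -cintD//; last exact: cintegrable_sum.
by apply: eq_cint => x; rewrite big_cons.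
Qed.

(** The factor 2 comes from bounding the real and imaginary parts separately; constants do not
    matter in the sequel. *)
Lemma normc_cint_le f a : cintegrable f ->
  mu.-integrable setT (EFin \o a) -> (forall x, normc (f x) <= a x) ->
  normc (cint f) <= 2 * Rintegral mu setT a.
Proof.
move=> [f1 f2] ia fa; apply: le_trans (normc_le_ReIm _) _ => /=.
rewrite mulr_natl mulr2n lerD//.
  apply: le_trans (le_normr_Rintegral _ _) _ => //.
  apply: le_Rintegral => //; first exact: (integrable_norm).
  by move=> x _; exact: le_trans (norm_Re_le _) (fa x).
apply: le_trans (le_normr_Rintegral _ _) _ => //.
apply: le_Rintegral => //; first exact: (integrable_norm).
by move=> x _; exact: le_trans (norm_Im_le _) (fa x).
Qed.

End complex_integral.

(** * Fubini for real and complex integrands *)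

Section product_integral.
Context d1 d2 (T1 : measurableType d1) (T2 : measurableType d2) (R : realType).
Variable m1 : {sigma_finite_measure set T1 -> \bar R}.
Variable m2 : {sigma_finite_measure set T2 -> \bar R}.

Lemma integrable_prodM (a : T1 -> R) (b : T2 -> R) :
  m1.-integrable setT (EFin \o a) -> m2.-integrable setT (EFin \o b) ->
  (m1 \x m2)%E.-integrable setT (EFin \o (fun z => a z.1 * b z.2)).
Proof.
move=> ia ib; apply/integrable12ltyP => /=.
  apply/measurable_EFinP; apply: measurable_funM.
    exact: (measurableT_comp (integrable_measurable ia) measurable_fst).
  exact: (measurableT_comp (integrable_measurable ib) measurable_snd).
rewrite [X in (X < _)%E](_ : _ =
    (\int[m1]_x (`|a x|%:E * \int[m2]_y `|b y|%:E))%E); last first.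
  apply: eq_integral => x _; rewrite -ge0_integralZl//.
  - by apply: eq_integral => y _; rewrite normrM EFinM.
  - apply/measurable_EFinP; apply: measurableT_comp => //.
    exact: integrable_measurable ib.
rewrite ge0_integralZr//.
- apply: lte_mul_pinfty.
  + exact: integral_ge0.
  + by rewrite ge0_fin_numE ?integral_ge0//; case/integrableP: ia.
  + by case/integrableP: ib.
- apply/measurable_EFinP; apply: measurableT_comp => //.
  exact: integrable_measurable ia.
- exact: integral_ge0.
Qed.

Lemma Rintegral_prodM (a : T1 -> R) (b : T2 -> R) :
  m1.-integrable setT (EFin \o a) -> m2.-integrable setT (EFin \o b) ->
  Rintegral (m1 \x m2)%E setT (fun z => a z.1 * b z.2) =
  Rintegral m1 setT a * Rintegral m2 setT b.
Proof.
move=> ia ib; rewrite /Rintegral -(integral12_prod_meas1 (integrable_prodM ia ib)).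
rewrite /fubini_F/=.
rewrite (_ : (\int[m1]_x _)%E =
    (\int[m1]_x ((a x)%:E * \int[m2]_y (b y)%:E))%E); last first.
  apply: eq_integral => x _; rewrite -integralZl//.
have fb := integrable_fin_num measurableT ib.
have fa := integrable_fin_num measurableT ia.
by rewrite -(fineK fb) integralZr// fineM// fineK.
Qed.

Lemma cintegrable_prodM (f : T1 -> R[i]) (g : T2 -> R[i]) :
  cintegrable m1 f -> cintegrable m2 g ->
  cintegrable (m1 \x m2)%E (fun z => f z.1 * g z.2).
Proof.
move=> [f1 f2] [g1 g2]; split.
  under eq_fun do rewrite ReM; apply: integrableBr.
    exact: (integrable_prodM f1 g1).
  exact: (integrable_prodM f2 g2).
under eq_fun do rewrite ImM; apply: integrableDr.
  exact: (integrable_prodM f1 g2).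
exact: (integrable_prodM f2 g1).
Qed.

Lemma cint_prodM (f : T1 -> R[i]) (g : T2 -> R[i]) :
  cintegrable m1 f -> cintegrable m2 g ->
  cint (m1 \x m2)%E (fun z => f z.1 * g z.2) = cint m1 f * cint m2 g.
Proof.
move=> [f1 f2] [g1 g2]; apply: complex_ext; rewrite ?ReM ?ImM/=.
  rewrite -!Rintegral_prodM// -RintegralB//; last 2 first.
  - exact: (integrable_prodM f1 g1).
  - exact: (integrable_prodM f2 g2).
  by apply: eq_Rintegral => x _; rewrite ReM.
rewrite -!Rintegral_prodM// -RintegralD//; last 2 first.
- exact: (integrable_prodM f1 g2).
- exact: (integrable_prodM f2 g1).
by apply: eq_Rintegral => x _; rewrite ImM.
Qed.

(** Integrability of every section makes each inner integral finite, so the [fine] inside the inner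
    [Rintegral] can be undone pointwise before Fubini is applied to extended integrals. *)
Lemma Rintegral_swap (h : T1 * T2 -> R) :
  (m1 \x m2)%E.-integrable setT (EFin \o h) ->
  (forall x, m2.-integrable setT (EFin \o (fun y => h (x, y)))) ->
  (forall y, m1.-integrable setT (EFin \o (fun x => h (x, y)))) ->
  Rintegral m1 setT (fun x => Rintegral m2 setT (fun y => h (x, y))) =
  Rintegral m2 setT (fun y => Rintegral m1 setT (fun x => h (x, y))).
Proof.
move=> ih i2 i1; rewrite /Rintegral; congr fine.
transitivity (\int[m1]_x \int[m2]_y (h (x, y))%:E)%E.
  apply: eq_integral => x _; rewrite fineK//.
  by apply: integrable_fin_num => //; exact: i2.
rewrite (Fubini ih); apply: eq_integral => y _; rewrite fineK//.
by apply: integrable_fin_num => //; exact: i1.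
Qed.

Lemma cint_swap (h : T1 * T2 -> R[i]) :
  cintegrable (m1 \x m2)%E h ->
  (forall x, cintegrable m2 (fun y => h (x, y))) ->
  (forall y, cintegrable m1 (fun x => h (x, y))) ->
  cint m1 (fun x => cint m2 (fun y => h (x, y))) =
  cint m2 (fun y => cint m1 (fun x => h (x, y))).
Proof.
move=> [h1 h2] i2 i1; apply: complex_ext => /=.
  by apply: (Rintegral_swap h1) => [x|y]; [case: (i2 x)|case: (i1 y)].
by apply: (Rintegral_swap h2) => [x|y]; [case: (i2 x)|case: (i1 y)].
Qed.

Lemma cintegrable_fst (h : T1 * T2 -> R[i]) :
  cintegrable (m1 \x m2)%E h ->
  (forall x, cintegrable m2 (fun y => h (x, y))) ->
  cintegrable m1 (fun x => cint m2 (fun y => h (x, y))).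
Proof.
move=> [h1 h2] i2; split => /=.
  have := integrable_fubini_F h1; apply: eq_integrable => // x _ /=.
  by rewrite fineK//; apply: integrable_fin_num => //; case: (i2 x).
have := integrable_fubini_F h2; apply: eq_integrable => // x _ /=.
by rewrite fineK//; apply: integrable_fin_num => //; case: (i2 x).
Qed.

End product_integral.

(** * Integration of tensor products over R^n *)

Section row_integral.
Context {R : realType}.

(** The integral of a nonnegative function is a supremum over the simple functions below it, hence
    monotone without measurability. This spares any measurability proof for the maximal function and
    for the Bessel potential. *)
Lemma ge0_le_integralT d (T : measurableType d) (mu : {measure set T -> \bar R})
    (f g : T -> \bar R) : (forall x, 0 <= f x)%E -> (forall x, f x <= g x)%E ->
  (\int[mu]_x f x <= \int[mu]_x g x)%E.
Proof.
move=> f0 fg; have g0 x : (0 <= g x)%E by exact: le_trans (fg x).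
rewrite !ge0_integralTE//; apply: le_ereal_sup => _ [h hf <-].
by exists h => // x; exact: le_trans (fg x).
Qed.

(* Every lebesgue_row R n is an iterated integral of indicators, so it is
   monotone on non-measurable sets as well. *)
Lemma le_lebesgue_row n (A B : set 'rV[R]_n) : A `<=` B ->
  (lebesgue_row R n A <= lebesgue_row R n B)%E.
Proof.
elim: n => [|n IHn] in A B * => AB /=.
  rewrite !diracE lee_fin; case: (boolP (_ \in A)) => // /set_mem /AB /mem_set ->.
  by [].
rewrite /lebesgue_row_cons /pushforward /product_measure1.
apply: ge0_le_integralT => [x|x] /=; first exact: measure_ge0.
by apply: IHn => y; rewrite /xsection /= !inE; exact: AB.
Qed.

Lemma row_cons_row_coord n (p : measurableTypeR R * 'rV[R]_n)
    (F : 'I_n.+1 -> R -> R[i]) :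
  \prod_i F i (row_cons p ord0 i) =
  F ord0 p.1 * \prod_i F (lift ord0 i) (p.2 ord0 i).
Proof.
rewrite big_ord_recl row_cons0; congr (_ * _).
by apply: eq_bigr => i _; rewrite row_consS.
Qed.

Lemma cmeasurable_tensor n (F : 'I_n -> R -> R[i]) :
  (forall i, cmeasurable (F i : measurableTypeR R -> R[i])) ->
  cmeasurable (fun x : 'rV[R]_n => \prod_i F i (x ord0 i)).
Proof.
move=> mF; elim: (index_enum _) => [|i s IHs].
  under [X in cmeasurable X]eq_fun do rewrite big_nil.
  by split; exact: measurable_cst.
under [X in cmeasurable X]eq_fun do rewrite big_cons.
apply: cmeasurableM => //; have [m1 m2] := mF i.
split.
  exact: (measurableT_comp m1 (measurable_row_coord i)).
exact: (measurableT_comp m2 (measurable_row_coord i)).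
Qed.

Lemma cintegrable_row_cons n (f : 'rV[R]_n.+1 -> R[i]) : cmeasurable f ->
  cintegrable (lebesgue_measure \x lebesgue_row R n)%E (f \o @row_cons R n) ->
  cintegrable (lebesgue_row R n.+1) f.
Proof.
move=> [m1 m2] [i1 i2]; split.
  apply: (integrable_pushforward (@measurable_row_cons R n) _ i1) => //.
  exact/measurable_EFinP.
apply: (integrable_pushforward (@measurable_row_cons R n) _ i2) => //.
exact/measurable_EFinP.
Qed.

Lemma cint_row_cons n (f : 'rV[R]_n.+1 -> R[i]) : cmeasurable f ->
  cintegrable (lebesgue_measure \x lebesgue_row R n)%E (f \o @row_cons R n) ->
  cint (lebesgue_row R n.+1) f =
  cint (lebesgue_measure \x lebesgue_row R n)%E (f \o @row_cons R n).
Proof.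
move=> [m1 m2] [i1 i2]; apply: complex_ext => /=; rewrite /Rintegral; congr fine.
  apply: (integral_pushforward (@measurable_row_cons R n) _ i1) => //.
  exact/measurable_EFinP.
apply: (integral_pushforward (@measurable_row_cons R n) _ i2) => //.
exact/measurable_EFinP.
Qed.

(** Fubini peels off the first coordinate; in dimension 0 the measure is a Dirac mass and both sides
    are 1. *)
Lemma cint_tensor n (F : 'I_n -> R -> R[i]) :
  (forall i, cintegrable (@lebesgue_measure R) (F i)) ->
  cintegrable (lebesgue_row R n) (fun x => \prod_i F i (x ord0 i)) /\
  cint (lebesgue_row R n) (fun x => \prod_i F i (x ord0 i)) =
  \prod_i cint (@lebesgue_measure R) (F i).
Proof.
elim: n => [|n IHn] in F * => iF.
  have -> : (fun x : 'rV[R]_0 => \prod_i F i (x ord0 i)) = cst 1.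
    by apply/funext => x; rewrite big_ord0.
  split.
    split; apply: finite_measure_integrable_cst => //=; rewrite diracT;
      exact: ltry.
  rewrite big_ord0 /cint /= !Rintegral_cst//=.
  by rewrite indicE in_setT mul1r mul0r.
have [i1 e1] := IHn (fun i => F (lift ord0 i)) (fun i => iF _).
have e2 : (fun x : 'rV[R]_n.+1 => \prod_i F i (x ord0 i)) \o @row_cons R n =
    (fun p : measurableTypeR R * 'rV[R]_n =>
      F ord0 p.1 * \prod_i F (lift ord0 i) (p.2 ord0 i)).
  by apply/funext => p; exact: row_cons_row_coord.
have mF : cmeasurable (fun x : 'rV[R]_n.+1 => \prod_i F i (x ord0 i)).
  by apply: cmeasurable_tensor => i; exact: cintegrable_cmeasurable (iF i).
have i2 : cintegrable (lebesgue_measure \x lebesgue_row R n)%E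
    ((fun x : 'rV[R]_n.+1 => \prod_i F i (x ord0 i)) \o @row_cons R n).
  by rewrite e2; exact: (cintegrable_prodM (iF ord0) i1).
split; first exact: cintegrable_row_cons.
rewrite cint_row_cons// e2 (cint_prodM (iF ord0) i1) big_ord_recl.
by rewrite e1.
Qed.

Lemma Rintegral_tensor n (F : 'I_n -> R -> R) :
  (forall i, (@lebesgue_measure R).-integrable setT (EFin \o F i)) ->
  (lebesgue_row R n).-integrable setT
    (EFin \o (fun x : 'rV[R]_n => \prod_i F i (x ord0 i))) /\
  Rintegral (lebesgue_row R n) setT (fun x => \prod_i F i (x ord0 i)) =
  \prod_i Rintegral (@lebesgue_measure R) setT (F i).
Proof.
move=> iF.
have ciF i : cintegrable (@lebesgue_measure R) (fun x => (F i x)%:C)%C.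
  by split; [exact: iF|exact: (integrable0 (@lebesgue_measure R) setT)].
have [[i1 _] e] := cint_tensor ciF.
have tE : (fun x : 'rV[R]_n => (\prod_i ((F i (x ord0 i))%:C)%C : R[i])) =
    (fun x => ((\prod_i F i (x ord0 i))%:C)%C).
  by apply/funext => x; rewrite real_complex_prod.
have cE i : cint (@lebesgue_measure R) (fun x => (F i x)%:C)%C =
    ((Rintegral (@lebesgue_measure R) setT (F i))%:C)%C.
  by apply: complex_ext => //=; rewrite Rintegral_cst// mul0r.
split.
  by move: i1; under eq_fun do rewrite -real_complex_prod.
move: e; under [RHS]eq_bigr do rewrite cE.
by rewrite -real_complex_prod tE => /(congr1 (@complex.Re R)).
Qed.

End row_integral.

(** * Affine substitution and integrals of derivatives on the line *)

Section real_line.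
Context {R : realType}.
Notation mu := (@lebesgue_measure R).
Implicit Types (f g G : R -> R) (a b x y t : R).

Lemma derive1_affine a b x : is_derive x 1 (fun x => a * x + b) a.
Proof.
have -> : (fun x => a * x + b) = (a *: @id R + cst b).
  by apply/funext => z /=.
by apply: is_derive_eq; rewrite addr0 /GRing.scale/= mulr1.
Qed.

Lemma is_derive_continuous f df : (forall x, is_derive x 1 f (df x)) ->
  continuous f.
Proof.
move=> Df x; apply/differentiable_continuous/derivable1_diffP.
by have [] := Df x.
Qed.

Lemma continuous_affine a b : continuous (fun x => a * x + b).
Proof. by apply: is_derive_continuous => x; exact: derive1_affine. Qed.

Lemma ge0_integral_affine a b G : 0 < a -> continuous G ->
  (forall x, 0 <= G x) ->
  (\int[mu]_x (G x)%:E = \int[mu]_x (G (a * x + b) * a)%:E)%E.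
Proof.
move=> a0 cG G0.
have dE : derive1 (fun x => a * x + b) = cst a.
  apply/funext => x; rewrite derive1E.
  exact: (@derive_val _ _ _ _ _ _ _ (derive1_affine a b x)).
rewrite (@increasing_ge0_integration_by_substitutionT _ (fun x => a * x + b))//.
- by rewrite dE.
- by move=> x y xy; rewrite ltrD2r ltr_pM2l.
- by rewrite dE; move=> x; exact: cvg_cst.
- by rewrite dE; exact: is_cvg_cst.
- by rewrite dE; exact: is_cvg_cst.
- apply/cvgrNyPle => M; exists ((M - b) / a); split; first exact: num_real.
  by move=> x; rewrite ltr_pdivlMr// ltrBrDr mulrC => /ltW.
- apply/cvgryPge => M; exists ((M - b) / a); split; first exact: num_real.
  by move=> x; rewrite ltr_pdivrMr// ltrBlDr mulrC => /ltW.
Qed.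

(** Positive and negative parts of G are continuous and nonnegative, and multiplication by a > 0
    commutes with taking the maximum with 0, so the nonnegative case applies to each. *)
Lemma integral_affine a b G : 0 < a -> continuous G ->
  (\int[mu]_x (G x)%:E = \int[mu]_x (G (a * x + b) * a)%:E)%E.
Proof.
move=> a0 cG.
have cmax (F : R -> R) : continuous F ->
    continuous (fun x => Num.max (F x) (0 : R)).
  by move=> cF x; apply: continuous_max; [exact: cF|exact: cvg_cst].
have cp := cmax G cG.
have cn : continuous (fun x => Num.max (- G x) 0).
  by apply: (cmax (fun x => - G x)) => x; apply: cvgN; exact: cG.
rewrite integralE [RHS]integralE; congr (_ - _)%E.
  under eq_integral do rewrite funeposE -EFin_max.
  rewrite (ge0_integral_affine b a0 cp); last by move=> x; rewrite le_max lexx orbT.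
  by apply: eq_integral => x _; rewrite funeposE -EFin_max maxr_pMl ?mul0r// ltW.
under eq_integral do rewrite funenegE -EFinN -EFin_max.
rewrite (ge0_integral_affine b a0 cn); last by move=> x; rewrite le_max lexx orbT.
apply: eq_integral => x _.
by rewrite funenegE -EFinN -EFin_max maxr_pMl ?mul0r ?mulNr// ltW.
Qed.

Lemma integrable_affine a b G : 0 < a -> continuous G ->
  mu.-integrable setT (EFin \o G) ->
  mu.-integrable setT (EFin \o (fun x => G (a * x + b))).
Proof.
move=> a0 cG /integrableP[_ iG].
have cGa : continuous (fun x => G (a * x + b)).
  by move=> x; apply: continuous_comp; [exact: continuous_affine|exact: cG].
apply/integrableP; split.
  by apply/measurable_EFinP; exact: continuous_measurable_fun.
have cnG : continuous (fun x => `|G x|).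
  by move=> x; apply: continuous_comp; [exact: cG|exact: norm_continuous].
move: iG; rewrite /= (ge0_integral_affine b a0 cnG)//.
under eq_integral do rewrite EFinM.
rewrite ge0_integralZr//.
- by case: integral => [r||]; rewrite ?ltry ?gt0_mulye ?lte_fin.
- apply/measurable_EFinP; apply: measurableT_comp => //.
  exact: continuous_measurable_fun.
- by rewrite lee_fin ltW.
Qed.

Lemma Rintegral_affine a b G : 0 < a -> continuous G ->
  mu.-integrable setT (EFin \o G) ->
  Rintegral mu setT G = a * Rintegral mu setT (fun x => G (a * x + b)).
Proof.
move=> a0 cG iG.
rewrite -RintegralZl//; last exact: integrable_affine.
rewrite /Rintegral (integral_affine b a0 cG); congr fine.
by apply: eq_integral => x _; rewrite mulrC.
Qed.

(** The fundamental theorem on [-(k + 1), k + 1] leaves boundary terms of size at most 2 K / (k +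
    1); dominated convergence passes to the whole line. *)
Lemma Rintegral_derive_eq0 g dg (K : R) : (forall x, is_derive x 1 g (dg x)) ->
  continuous dg -> mu.-integrable setT (EFin \o dg) ->
  (forall x, `|x * g x| <= K) -> Rintegral mu setT dg = 0.
Proof.
move=> Dg cdg idg gK.
have K0 : 0 <= K by apply: le_trans (gK 0); exact: normr_ge0.
have cg := is_derive_continuous Dg.
pose I k : set R := `[- k.+1%:R, k.+1%:R]%classic.
have IE k : (\int[mu]_(x in I k) (dg x)%:E =
    (g k.+1%:R - g (- k.+1%:R))%:E)%E.
  rewrite EFinB; apply: continuous_FTC2.
  - by rewrite gtrN.
  - by apply: continuous_subspaceT.
  - split => [x _||]; first by have [] := Dg x.
      by apply: cvg_at_right_filter; exact: cg.
    by apply: cvg_at_left_filter; exact: cg.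
  - move=> x _; rewrite derive1E.
    exact: (@derive_val _ _ _ _ _ _ _ (Dg x)).
have mdg := integrable_measurable idg.
pose f_ k : measurableTypeR R -> \bar R := (EFin \o dg) \_ (I k).
have mf_ k : measurable_fun [set: measurableTypeR R] (f_ k).
  apply: (iffLR (measurable_restrictT (EFin \o dg) _)).
    exact: measurable_itv.
  by apply: measurable_funTS; exact/measurable_EFinP.
have mf : measurable_fun [set: measurableTypeR R] (EFin \o dg) by exact/measurable_EFinP.
have f_f : {ae mu, forall x, [set: measurableTypeR R] x ->
    f_ ^~ x @ \oo --> (EFin \o dg) x}.
  apply: aeW => x _; apply: cvg_near_cst; exists (Num.truncn `|x|) => // k /= kx.
  rewrite /f_ patchE mem_set// /I /= in_itv/= -ler_norml.
  by apply: ltW; apply: lt_le_trans (truncnS_gt _) _; rewrite ler_nat ltnS.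
have f_g : {ae mu, forall x k, [set: measurableTypeR R] x ->
    (`|f_ k x| <= (EFin \o (Num.norm \o dg)) x)%E}.
  by apply: aeW => x k _; rewrite /f_ patchE; case: ifP => //= _; rewrite normr0 lee_fin.
have [_ _] := dominated_convergence measurableT mf_ mf f_f
  (integrable_norm idg) f_g.
move=> c; rewrite /Rintegral -[0]/(fine 0%:E); congr fine; apply/esym.
apply: (cvg_unique _ _ c) => //=.
rewrite (_ : (fun k => _) = (fun k => (g k.+1%:R - g (- k.+1%:R))%:E)); last first.
  by apply/funext => k; rewrite -IE [RHS]integral_mkcond.
apply: cvg_EFin; first exact: nearW.
have b k : `|g k.+1%:R - g (- k.+1%:R)| <= 2 * K * k.+1%:R^-1.
  have h x : x != 0 -> `|g x| <= K * `|x|^-1.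
    move=> x0; rewrite ler_pdivlMr ?normr_gt0//.
    by rewrite -normrM mulrC.
  apply: le_trans (ler_normB _ _) _.
  have := lerD (h k.+1%:R _) (h (- k.+1%:R) _).
  rewrite oppr_eq0 pnatr_eq0 normrN normr_nat => /(_ isT isT).
  by move=> /le_trans; apply; rewrite -mulrA mulr_natl mulr2n.
apply: norm_cvg0.
apply: (@squeeze_cvgr _ _ _ _ (cst 0) (fun k => 2 * K * k.+1%:R^-1)).
- by apply: nearW => k; rewrite /= normr_ge0 b.
- exact: cvg_cst.
- rewrite -[X in _ --> X](mulr0 (2 * K)); apply: cvgMr.
  exact: cvg_harmonic.
Qed.

End real_line.

(** * Derivation rules in pointwise form, with explicit derivatives *)

Section derivation_rules.
Context {R : realType}.
Implicit Types (f g : R -> R) (x df dg : R).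

Lemma is_derive1D f g x df dg : is_derive x 1 f df -> is_derive x 1 g dg ->
  is_derive x 1 (fun x => f x + g x) (df + dg).
Proof. by move=> Df Dg; exact: is_deriveD. Qed.

Lemma is_derive1B f g x df dg : is_derive x 1 f df -> is_derive x 1 g dg ->
  is_derive x 1 (fun x => f x - g x) (df - dg).
Proof. by move=> Df Dg; exact: is_deriveB. Qed.

Lemma is_derive1M f g x df dg : is_derive x 1 f df -> is_derive x 1 g dg ->
  is_derive x 1 (fun x => f x * g x) (df * g x + f x * dg).
Proof.
move=> Df Dg; have := is_deriveM Df Dg.
by rewrite addrC /GRing.scale/= (mulrC (g x)).
Qed.

Lemma is_derive1V f x df : f x != 0 -> is_derive x 1 f df ->
  is_derive x 1 (fun x => (f x)^-1) (- f x ^- 2 * df).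
Proof.
move=> fx0 Df; have [df1 <-] := Df; apply: DeriveDef.
  exact: (derivableV fx0 df1).
by rewrite (deriveV fx0 df1).
Qed.

Lemma is_derive1Z (k : R) f x df : is_derive x 1 f df ->
  is_derive x 1 (fun x => k * f x) (k * df).
Proof. by move=> Df; exact: (is_deriveZ k Df). Qed.

Lemma is_derive1_pow n x : is_derive x 1 (fun x : R => x ^+ n) (n%:R * x ^+ n.-1).
Proof.
have := is_deriveX n (is_derive_id x 1).
rewrite /GRing.scale/= mulr1; congr is_derive.
apply/funext => z; elim: n => [|n IH]; first by rewrite !expr0.
by rewrite !exprS -IH.
Qed.

Lemma is_derive1_compose f g x df dg : is_derive (g x) 1 f df ->
  is_derive x 1 g dg -> is_derive x 1 (fun x => f (g x)) (df * dg).
Proof. by move=> Df Dg; exact: (is_derive1_comp Df Dg). Qed.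

Lemma is_derive1_eq f g x df dg : is_derive x 1 f df -> f =1 g -> df = dg ->
  is_derive x 1 g dg.
Proof. by move=> Df /funext <- <-. Qed.

End derivation_rules.

(** * Moments of Gaussians with a quadratic phase *)

Section gaussian_moments.
Context {R : realType}.
Notation mu := (@lebesgue_measure R).
Implicit Types (T f : R -> R) (l : nat) (x y t : R).

Lemma exp_ge_pow l (u : R) : 0 <= u -> u ^+ l <= l`!%:R * expR u.
Proof.
move=> u0; case: l => [|l].
  by rewrite expr0 fact0 mul1r -expR0 ler_expR.
rewrite -ler_pdivrMl ?ltr0n ?fact_gt0// mulrC.
by apply: le_trans (expR_ge1Dxn l u0); rewrite lerDr.
Qed.

Definition pow_gauss_bound l : R := 1 + 2 ^+ l * l`!%:R.

Lemma pow_gauss_bound_ge0 l : 0 <= pow_gauss_bound l.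
Proof. by rewrite addr_ge0// mulr_ge0// exprn_ge0. Qed.

(** Half of the Gaussian absorbs the power: with u = x^2 / 2, |x|^l <= 1 + (2 u)^l <= (1 + 2^l l!)
    e^u, which is the origin of [pow_gauss_bound]. *)
Lemma pow_gauss_le l x : `|x| ^+ l * expR (- x ^+ 2) <=
  pow_gauss_bound l * expR (- (x ^+ 2 / 2)).
Proof.
set u := x ^+ 2 / 2; have u0 : 0 <= u by rewrite divr_ge0// sqr_ge0.
have -> : - x ^+ 2 = - u + - u by rewrite /u; lra.
rewrite expRD mulrA ler_wpM2r ?expR_ge0// expRN ler_pdivrMr ?expR_gt0//.
have e1 : 1 <= expR u by rewrite -expR0 ler_expR.
have xl : `|x| ^+ l <= 1 + (x ^+ 2) ^+ l.
  have [x1|x1] := leP `|x| 1.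
    apply: (@le_trans _ _ 1); first exact: exprn_ile1.
    by rewrite lerDl exprn_ge0// sqr_ge0.
  apply: (@le_trans _ _ ((x ^+ 2) ^+ l)); last by rewrite lerDr.
  rewrite -real_normK ?num_real// -exprM ler_weXn2l ?(ltW x1)//.
  by rewrite leq_pmull.
apply: (le_trans xl); rewrite /pow_gauss_bound mulrDl mul1r lerD//.
have -> : x ^+ 2 = 2 * u by rewrite /u; lra.
by rewrite exprMn -mulrA ler_wpM2l ?exprn_ge0// exp_ge_pow.
Qed.

Lemma continuous_expRN f : continuous f -> continuous (fun x => expR (- f x)).
Proof.
by move=> cf x; apply: continuous_comp; [apply: cvgN; exact: cf|exact: continuous_expR].
Qed.

Lemma integrable_gauss_half : mu.-integrable setT
  (EFin \o (fun x : R => expR (- (x ^+ 2 / 2)))).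
Proof.
have a0 : 0 < (Num.sqrt 2)^-1 :> R by rewrite invr_gt0 sqrtr_gt0.
have := integrable_affine 0 a0 (@continuous_gauss_fun R) (@integrableT_gauss R).
congr (_.-integrable _ _); apply/funext => x /=.
by rewrite /gauss_fun addr0 exprMn exprVn sqr_sqrtr// mulrC.
Qed.

(** For T = cos and T = sin these are the real and imaginary parts of x^l exp(i (y x - t x^2) -
    x^2). Leaving T abstract treats both at once: differentiating the phase replaces T by T'. *)
Definition osc_fun T l y t x := x ^+ l * T (y * x - t * x ^+ 2) * expR (- x ^+ 2).

Definition osc T l y t := Rintegral mu setT (osc_fun T l y t).

Definition gauss_moment l := Rintegral mu setT
  (fun x : R => `|x| ^+ l * expR (- x ^+ 2)).

Lemma integrable_gauss_moment l : mu.-integrable setT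
  (EFin \o (fun x : R => `|x| ^+ l * expR (- x ^+ 2))).
Proof.
apply: integrable_le (integrable_mull (pow_gauss_bound l) integrable_gauss_half).
  apply: measurable_funM.
    apply: continuous_measurable_fun => x.
    apply: (@continuous_comp _ _ _ (fun x => `|x|) (fun x => x ^+ l)).
      exact: norm_continuous.
    exact: exprn_continuous.
  by apply: continuous_measurable_fun; apply: continuous_expRN => x;
    exact: exprn_continuous.
move=> x; rewrite ger0_norm; first exact: pow_gauss_le.
by rewrite mulr_ge0 ?exprn_ge0 ?expR_ge0.
Qed.

Lemma gauss_moment_ge0 l : 0 <= gauss_moment l.
Proof.
by apply: Rintegral_ge0 => x _; rewrite mulr_ge0 ?exprn_ge0 ?expR_ge0.
Qed.

Lemma continuous_osc_fun T l y t : continuous T -> continuous (osc_fun T l y t).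
Proof.
move=> cT x; apply: (@continuousM _ _ (fun x => x ^+ l * T (y * x - t * x ^+ 2))).
  apply: (@continuousM _ _ (fun x => x ^+ l)); first exact: exprn_continuous.
  apply: (@continuous_comp _ _ _ (fun x => y * x - t * x ^+ 2)); last exact: cT.
  apply: (@continuousB _ _ _ (fun x => y * x) (fun x => t * x ^+ 2)).
    exact: mulrl_continuous.
  apply: (@continuous_comp _ _ _ (fun x => x ^+ 2) (fun x => t * x)).
    exact: exprn_continuous.
  exact: mulrl_continuous.
by apply: continuous_expRN => {}x; exact: exprn_continuous.
Qed.

Lemma norm_osc_fun_le T l y t x : (forall z, `|T z| <= 1) ->
  `|osc_fun T l y t x| <= `|x| ^+ l * expR (- x ^+ 2).
Proof.
move=> T1; rewrite /osc_fun !normrM normrX (ger0_norm (expR_ge0 _)).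
by rewrite ler_wpM2r ?expR_ge0// ler_piMr ?exprn_ge0.
Qed.

Lemma integrable_osc_fun T l y t : continuous T -> (forall z, `|T z| <= 1) ->
  mu.-integrable setT (EFin \o osc_fun T l y t).
Proof.
move=> cT T1; apply: integrable_le (integrable_gauss_moment l).
  by apply: continuous_measurable_fun; exact: continuous_osc_fun.
by move=> x; exact: norm_osc_fun_le.
Qed.

Lemma norm_osc_le T l y t : continuous T -> (forall z, `|T z| <= 1) ->
  `|osc T l y t| <= gauss_moment l.
Proof.
move=> cT T1; apply: le_trans (le_normr_Rintegral _ _) _ => //.
  exact: integrable_osc_fun.
apply: le_Rintegral => //.
- exact: (integrable_norm (integrable_osc_fun l y t cT T1)).
- exact: integrable_gauss_moment.
- by move=> x _; exact: norm_osc_fun_le.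
Qed.

Lemma is_derive_osc_fun T T' l y t x : (forall z : R, is_derive z 1 T (T' z)) ->
  is_derive x 1 (osc_fun T l y t)
    (l%:R * osc_fun T l.-1 y t x + y * osc_fun T' l y t x
     - 2 * t * osc_fun T' l.+1 y t x - 2 * osc_fun T l.+1 y t x).
Proof.
move=> DT.
have Dphi : is_derive x 1 (fun x => y * x - t * x ^+ 2)
    (y * 1 - t * (2%:R * x ^+ 1)).
  exact: (is_derive1B (is_derive1Z y (is_derive_id x 1))
    (is_derive1Z t (is_derive1_pow 2 x))).
have Dexp : is_derive x 1 (fun x => expR (- x ^+ 2))
    (expR (- x ^+ 2) * (- 1 * (2%:R * x ^+ 1))).
  apply: (is_derive1_compose (is_derive_expR _)).
  apply: (is_derive1_eq (is_derive1Z (-1) (is_derive1_pow 2 x))) => // z.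
  by rewrite mulN1r.
apply: (is_derive1_eq (is_derive1M (is_derive1M (is_derive1_pow l x)
  (is_derive1_compose (DT _) Dphi)) Dexp)) => //.
rewrite /osc_fun !exprS expr0; ring.
Qed.

(* Integrates the derivative of x^l T(y x - t x^2) e^(-x^2) over the line. *)
Lemma osc_rec T T' l y t : continuous T -> continuous T' ->
  (forall z, `|T z| <= 1) -> (forall z, `|T' z| <= 1) ->
  (forall z : R, is_derive z 1 T (T' z)) ->
  l%:R * osc T l.-1 y t + y * osc T' l y t - 2 * t * osc T' l.+1 y t
  - 2 * osc T l.+1 y t = 0.
Proof.
move=> cT cT' T1 T'1 DT.
have iT k := integrable_osc_fun k y t cT T1.
have iT' k := integrable_osc_fun k y t cT' T'1.
have i1 := integrable_mull l%:R (iT l.-1).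
have i2 := integrable_mull y (iT' l).
have i3 := integrable_mull (2 * t) (iT' l.+1).
have i4 := integrable_mull 2 (iT l.+1).
have i12 := integrableDr i1 i2.
have i123 := integrableBr i12 i3.
have i := integrableBr i123 i4.
rewrite /osc -(RintegralZl l%:R measurableT (iT l.-1)).
rewrite -(RintegralZl y measurableT (iT' l)) -(RintegralZl _ measurableT (iT' l.+1)).
rewrite -(RintegralZl 2 measurableT (iT l.+1)) -RintegralD// -RintegralB// -RintegralB//.
apply: (Rintegral_derive_eq0 (fun x => is_derive_osc_fun l y t x DT) _ i
  (K := pow_gauss_bound l.+1)).
  have c (U : R -> R) k : continuous U ->
      forall a, continuous (fun x => a * osc_fun U k y t x).
    move=> cU a x; apply: (@continuous_comp _ _ _ (osc_fun U k y t) (fun x => a * x)).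
      exact: continuous_osc_fun.
    exact: mulrl_continuous.
  move=> x; apply: (@continuousB _ _ _ (fun x => l%:R * osc_fun T l.-1 y t x + y * osc_fun T' l y t x
     - 2 * t * osc_fun T' l.+1 y t x)); last exact: c.
  apply: (@continuousB _ _ _ (fun x => l%:R * osc_fun T l.-1 y t x + y * osc_fun T' l y t x));
    last exact: c.
  by apply: (@continuousD _ _ _ (fun x => l%:R * osc_fun T l.-1 y t x)); exact: c.
move=> x; have -> : x * osc_fun T l y t x = osc_fun T l.+1 y t x.
  by rewrite /osc_fun (exprS x l) !mulrA.
apply: (le_trans (norm_osc_fun_le _ _ _ _ T1)).
apply: (le_trans (pow_gauss_le _ _)).
rewrite ler_piMr ?pow_gauss_bound_ge0// -expR0 ler_expR oppr_le0.
by rewrite divr_ge0// sqr_ge0.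
Qed.

(** Moving along the ray (r y, r t) reduces the evaluation at (y, t) to an ordinary differential
    equation in r whose value at r = 0 is the plain Gaussian integral. *)
Lemma is_derive_osc T T' y t (a : R) : continuous T -> continuous T' ->
  (forall z, `|T z| <= 1) -> (forall z, `|T' z| <= 1) ->
  (forall z : R, is_derive z 1 T (T' z)) ->
  is_derive a 1 (fun r => osc T 0 (r * y) (r * t))
    (y * osc T' 1 (a * y) (a * t) - t * osc T' 2 (a * y) (a * t)).
Proof.
move=> cT cT' T1 T'1 DT.
pose f (r : R) (x : R) := osc_fun T 0 (r * y) (r * t) x.
have Df (r x : R) : is_derive r 1 (f ^~ x)
    (y * osc_fun T' 1 (r * y) (r * t) x - t * osc_fun T' 2 (r * y) (r * t) x).
  have Dphi : is_derive r 1 (fun r => r * y * x - r * t * x ^+ 2)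
      ((y * x - t * x ^+ 2) * 1).
    apply: (is_derive1_eq (is_derive1Z (y * x - t * x ^+ 2) (is_derive_id r 1))) => //.
    by move=> z /=; ring.
  apply: (is_derive1_eq (is_derive1Z (expR (- x ^+ 2)) (is_derive1_compose (DT _) Dphi))).
    by move=> z; rewrite /f /osc_fun expr0 mul1r mulrC.
  by rewrite /osc_fun expr1; ring.
have d1f r x : partial1of2 f r x =
    y * osc_fun T' 1 (r * y) (r * t) x - t * osc_fun T' 2 (r * y) (r * t) x.
  by rewrite partial1of2E; exact: (@derive_val _ _ _ _ _ _ _ (Df r x)).
(* This majorant of the r-derivative does not involve r, so any neighbourhood of a would do; the
   radius 1 is arbitrary. *)
pose G (x : R) := `|y| * (`|x| ^+ 1 * expR (- x ^+ 2)) + `|t| * (`|x| ^+ 2 * expR (- x ^+ 2)).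
have aI : `]a - 1, a + 1[%classic a by rewrite /= in_itv/= ltrBlDr ltrDl ltr01.
have intf r : `]a - 1, a + 1[%classic r -> mu.-integrable setT (EFin \o f r).
  by move=> _; exact: integrable_osc_fun.
have derf r x : `]a - 1, a + 1[%classic r -> setT x -> derivable (f ^~ x) r 1.
  by move=> _ _; have [] := Df r x.
have G0 x : 0 <= G x.
  by rewrite addr_ge0// !mulr_ge0 ?normr_ge0 ?exprn_ge0 ?expR_ge0.
have iG : mu.-integrable setT (EFin \o G).
  by apply: integrableDr; apply: integrable_mull; exact: integrable_gauss_moment.
have Gub r x : `]a - 1, a + 1[%classic r -> setT x -> `|partial1of2 f r x| <= G x.
  move=> _ _; rewrite d1f; apply: (le_trans (ler_normB _ _)).
  by apply: lerD; rewrite normrM ler_wpM2l//; exact: norm_osc_fun_le.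
apply: DeriveDef.
  exact: (derivable_under_integral measurableT aI intf derf G0 iG Gub).
rewrite -derive1E (differentiation_under_integral measurableT aI intf derf G0 iG Gub).
have i1 := integrable_osc_fun 1 (a * y) (a * t) cT' T'1.
have i2 := integrable_osc_fun 2 (a * y) (a * t) cT' T'1.
rewrite /osc -!RintegralZl// -RintegralB//; last 2 first.
- exact: integrable_mull.
- exact: integrable_mull.
by apply: eq_Rintegral => x _; rewrite d1f.
Qed.

End gaussian_moments.

(** * Modulus, value at t = 0, and decay of the oscillatory Gaussian moments *)

Section gaussian_oscillatory_integrals.
Context {R : realType}.
Implicit Types (l : nat) (x y t r : R).
Notation c := (osc (@cos R)).
Notation s := (osc (@sin R)).

Lemma continuous_Nsin : continuous (fun z : R => - sin z).
Proof. by move=> z; apply: cvgN; exact: continuous_sin. Qed.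

Lemma norm_Nsin_le (z : R) : `|- sin z| <= 1.
Proof. by rewrite normrN sin_max. Qed.

Lemma osc_Nsin l y t : osc (fun z : R => - sin z) l y t = - s l y t.
Proof.
rewrite /osc -mulN1r -RintegralZl//.
  by apply: eq_Rintegral => x _; rewrite /osc_fun; ring.
by apply: integrable_osc_fun; [exact: continuous_sin|exact: sin_max].
Qed.

Lemma osc_cos_rec l y t :
  l%:R * c l.-1 y t - y * s l y t + 2 * t * s l.+1 y t - 2 * c l.+1 y t = 0.
Proof.
have := osc_rec l y t (@continuous_cos R) continuous_Nsin (@cos_max R)
  norm_Nsin_le (@is_derive_cos R).
by rewrite !osc_Nsin => <-; ring.
Qed.

Lemma osc_sin_rec l y t :
  l%:R * s l.-1 y t + y * c l y t - 2 * t * c l.+1 y t - 2 * s l.+1 y t = 0.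
Proof.
exact: (osc_rec l y t (@continuous_sin R) (@continuous_cos R) (@sin_max R)
  (@cos_max R) (@is_derive_sin R)).
Qed.

Lemma is_derive_osc_cos y t r : is_derive r 1 (fun r => c 0 (r * y) (r * t))
  (t * s 2 (r * y) (r * t) - y * s 1 (r * y) (r * t)).
Proof.
apply: (is_derive1_eq (is_derive_osc y t r (@continuous_cos R) continuous_Nsin
  (@cos_max R) norm_Nsin_le (@is_derive_cos R))) => //.
by rewrite !osc_Nsin; ring.
Qed.

Lemma is_derive_osc_sin y t r : is_derive r 1 (fun r => s 0 (r * y) (r * t))
  (y * c 1 (r * y) (r * t) - t * c 2 (r * y) (r * t)).
Proof.
exact: (is_derive_osc y t r (@continuous_sin R) (@continuous_cos R)
  (@sin_max R) (@cos_max R) (@is_derive_sin R)).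
Qed.

Lemma osc_cos000 : c 0 0 0 = Num.sqrt pi.
Proof.
rewrite /osc -[RHS]/(fine (Num.sqrt pi)%:E) -integralT_gauss /Rintegral.
congr fine; apply: eq_integral => x _.
by rewrite /osc_fun /gauss_fun expr0 !mul0r subrr cos0 !mul1r.
Qed.

Lemma osc_sin000 : s 0 0 0 = 0.
Proof.
rewrite /osc -[RHS](Rintegral_set0 (@lebesgue_measure R) (cst 0)) /Rintegral.
congr fine; rewrite integral_set0; apply: integral0_eq => x _.
by rewrite /osc_fun !mul0r subrr sin0 mulr0 mul0r.
Qed.

(* The quantity Q in the proof is constant along the ray r |-> (r y, r t). *)
Lemma osc_norm y t : (c 0 y t ^+ 2 + s 0 y t ^+ 2) ^+ 2 * (1 + t ^+ 2) =
  pi ^+ 2 * expR (- (y ^+ 2 / (1 + t ^+ 2))).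
Proof.
pose C r := c 0 (r * y) (r * t); pose S r := s 0 (r * y) (r * t).
pose D r : R := 1 + t ^+ 2 * r ^+ 2.
have D0 r : D r != 0.
  by rewrite gt_eqF// ltr_pwDl// mulr_ge0// sqr_ge0.
(* The squared modulus should be pi (1 + t^2)^(-1/2) exp(-y^2 / (2 (1 + t^2))). Squaring once more
   removes the root, and Q divides by the expected dependence on r. *)
pose Q r := (C r ^+ 2 + S r ^+ 2) ^+ 2 * D r * expR (y ^+ 2 * r ^+ 2 / D r).
have DQ r : is_derive r 1 Q 0.
  have Dsq : is_derive r 1 (fun r : R => r ^+ 2) (2%:R * r ^+ 1) by exact: is_derive1_pow.
  have DD : is_derive r 1 D (0 + t ^+ 2 * (2%:R * r ^+ 1)).
    by apply: is_derive1D; exact: is_derive1Z.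
  have sqr (f : R -> R) (df : R) : is_derive r 1 f df -> is_derive r 1 (fun z : R => f z ^+ 2 : R) (2%:R * f r ^+ 1 * df).
    by move=> Df; exact: (is_derive1_compose (is_derive1_pow 2 (f r)) Df).
  have DC := is_derive_osc_cos y t r; have DS := is_derive_osc_sin y t r.
  have DN := sqr _ _ (is_derive1D (sqr _ _ DC) (sqr _ _ DS)).
  have DI : is_derive r 1 (fun r => (D r)^-1) (- D r ^- 2 * (0 + t ^+ 2 * (2%:R * r ^+ 1))).
    exact: is_derive1V.
  have DE := is_derive1_compose (is_derive_expR _) (is_derive1M (is_derive1Z (y ^+ 2) Dsq) DI).
  apply: (is_derive1_eq (is_derive1M (is_derive1M DN DD) DE)) => //.
  have c1 := osc_cos_rec 0 (r * y) (r * t); have s1 := osc_sin_rec 0 (r * y) (r * t).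
  have c2 := osc_cos_rec 1 (r * y) (r * t); have s2 := osc_sin_rec 1 (r * y) (r * t).
  move: c1 s1 c2 s2 (D0 r); rewrite /= /D.
  set c0 := c 0 _ _; set s0 := s 0 _ _; set c1 := c 1 _ _; set s1 := s 1 _ _.
  set c2 := c 2 _ _; set s2 := s 2 _ _; set e := expR _.
  move=> e1 e2 e3 e4 Dn0.
  (* The recurrences for l = 0 and l = 1 are linear systems in (c1, s1) and (c2, s2) of determinant
     4 (1 + r^2 t^2). Eliminating an unknown needs one equation multiplied by r t; these products
     are supplied because [lra] only combines hypotheses with constant coefficients. *)
  have T1 : r * t * (0 * c0 - r * y * s0 + 2 * (r * t) * s1 - 2 * c1) = 0 by rewrite e1 mulr0.
  have T2 : r * t * (0 * s0 + r * y * c0 - 2 * (r * t) * c1 - 2 * s1) = 0 by rewrite e2 mulr0.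
  have T3 : r * t * (1 * c0 - r * y * s1 + 2 * (r * t) * s2 - 2 * c2) = 0 by rewrite e3 mulr0.
  have T4 : r * t * (1 * s0 + r * y * c1 - 2 * (r * t) * c2 - 2 * s2) = 0 by rewrite e4 mulr0.
  have E1 : c1 = (- (r * y) * s0 + r * t * (r * y) * c0) / 2 / (1 + t ^+ 2 * r ^+ 2).
    by apply: (mulIf Dn0); rewrite divfK//; move: T2; lra.
  have E2 : s1 = (r * y * c0 + r * t * (r * y) * s0) / 2 / (1 + t ^+ 2 * r ^+ 2).
    by apply: (mulIf Dn0); rewrite divfK//; move: T1; lra.
  have E3 : c2 = ((c0 - r * y * s1) + r * t * (s0 + r * y * c1)) / 2 / (1 + t ^+ 2 * r ^+ 2).
    by apply: (mulIf Dn0); rewrite divfK//; move: T4; lra.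
  have E4 : s2 = ((s0 + r * y * c1) - r * t * (c0 - r * y * s1)) / 2 / (1 + t ^+ 2 * r ^+ 2).
    by apply: (mulIf Dn0); rewrite divfK//; move: T3; lra.
  rewrite E3 E4 E1 E2; field.
  by rewrite exprMn.
have := is_derive_0_is_cst 1 0 DQ.
rewrite /Q /C /S /D !mul1r !mul0r !expr1n osc_cos000 osc_sin000 !expr0n /=.
rewrite !mulr0 mul0r expR0 !addr0 !mulr1 sqr_sqrtr ?pi_ge0// => <-.
by rewrite -!mulrA -expRD subrr expR0 mulr1.
Qed.

(** [osc_norm] leaves the phase undetermined. At t = 0 the value itself is needed, for the Fourier
    transform of the packet, and the same ray argument gives it. *)
Lemma osc_cos0 y : c 0 y 0 = Num.sqrt pi * expR (- (y ^+ 2 / 4)).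
Proof.
pose Q r := c 0 (r * y) (r * 0) * expR (y ^+ 2 / 4 * r ^+ 2).
have DQ r : is_derive r 1 Q 0.
  have DE := is_derive1_compose (is_derive_expR _) (is_derive1Z (y ^+ 2 / 4) (is_derive1_pow 2 r)).
  apply: (is_derive1_eq (is_derive1M (is_derive_osc_cos y 0 r) DE)) => //.
  have s1 := osc_sin_rec 0 (r * y) (r * 0); rewrite /= in s1.
  have -> : s 1 (r * y) (r * 0) = r * y * c 0 (r * y) (r * 0) / 2 by lra.
  by field.
have := is_derive_0_is_cst 1 0 DQ.
rewrite /Q !mul1r !mul0r expr1n mulr1 expr0n /= mulr0 expR0 mulr1 osc_cos000 => <-.
by rewrite -mulrA -expRD subrr expR0 mulr1.
Qed.

Lemma osc_sin0 y : s 0 y 0 = 0.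
Proof.
pose Q r := s 0 (r * y) (r * 0) * expR (y ^+ 2 / 4 * r ^+ 2).
have DQ r : is_derive r 1 Q 0.
  have DE := is_derive1_compose (is_derive_expR _) (is_derive1Z (y ^+ 2 / 4) (is_derive1_pow 2 r)).
  apply: (is_derive1_eq (is_derive1M (is_derive_osc_sin y 0 r) DE)) => //.
  have c1 := osc_cos_rec 0 (r * y) (r * 0); rewrite /= in c1.
  have -> : c 1 (r * y) (r * 0) = - (r * y * s 0 (r * y) (r * 0) / 2) by lra.
  by field.
have := is_derive_0_is_cst 1 0 DQ.
rewrite /Q !mul1r !mul0r expr1n mulr1 osc_sin000 mul0r => /eqP.
by rewrite mulf_eq0 expR_eq0 orbF => /eqP.
Qed.

Definition osc_bound1 l : R := l%:R * gauss_moment l.-1 + 2 * gauss_moment l.+1.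
Definition osc_bound l : R :=
  gauss_moment l + 2 * osc_bound1 l.+1 + l%:R * osc_bound1 l.-1.

Lemma osc_bound1_ge0 l : 0 <= osc_bound1 l.
Proof. by rewrite addr_ge0// mulr_ge0// gauss_moment_ge0. Qed.

Lemma osc_bound_ge0 l : 0 <= osc_bound l.
Proof.
by rewrite !addr_ge0 ?gauss_moment_ge0// mulr_ge0// osc_bound1_ge0.
Qed.

Lemma osc_decay1 l y : `|y * c l y 0| <= osc_bound1 l /\
  `|y * s l y 0| <= osc_bound1 l.
Proof.
have nc k := norm_osc_le k y 0 (@continuous_cos R) (@cos_max R).
have ns k := norm_osc_le k y 0 (@continuous_sin R) (@sin_max R).
have e1 := osc_cos_rec l y 0; have e2 := osc_sin_rec l y 0.
have b (u v : R) : `|u| <= gauss_moment l.-1 -> `|v| <= gauss_moment l.+1 ->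
    `|l%:R * u - 2 * v| <= osc_bound1 l.
  move=> hu hv; apply: (le_trans (ler_normB _ _)).
  by rewrite !normrM !normr_nat lerD// ler_wpM2l.
split.
  have -> : y * c l y 0 = - (l%:R * s l.-1 y 0 - 2 * s l.+1 y 0) by lra.
  by rewrite normrN b.
have -> : y * s l y 0 = l%:R * c l.-1 y 0 - 2 * c l.+1 y 0 by lra.
exact: b.
Qed.

(** At t = 0 the recurrence trades a factor y for shifts of l by one. Two uses bound y^2 times the
    moment, and the result is integrable in y; [osc_bound] adds up these terms and the trivial
    bound. *)
Lemma osc_decay l y : `|c l y 0| <= osc_bound l / (1 + y ^+ 2) /\
  `|s l y 0| <= osc_bound l / (1 + y ^+ 2).
Proof.
have p : 0 < 1 + y ^+ 2 by rewrite ltr_pwDl// sqr_ge0.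
have nc k := norm_osc_le k y 0 (@continuous_cos R) (@cos_max R).
have ns k := norm_osc_le k y 0 (@continuous_sin R) (@sin_max R).
have e1 := osc_cos_rec l y 0; have e2 := osc_sin_rec l y 0.
have b (u v w : R) : `|w| <= gauss_moment l ->
    `|u| <= osc_bound1 l.-1 -> `|v| <= osc_bound1 l.+1 ->
    `|w| + `|l%:R * u - 2 * v| <= osc_bound l.
  move=> hw hu hv; rewrite /osc_bound -addrA lerD// addrC.
  apply: (le_trans (ler_normB _ _)).
  by rewrite !normrM !normr_nat lerD// ler_wpM2l.
have n2 (w : R) : `|w| * (1 + y ^+ 2) = `|w| + `|y * (y * w)|.
  by rewrite mulrDr mulr1 !normrM mulrA mulrC -expr2 real_normK ?num_real// mulrC.
have [h1 h2] := osc_decay1 l.-1 y; have [h3 h4] := osc_decay1 l.+1 y.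
split; rewrite ler_pdivlMr// n2.
  have -> : y * (y * c l y 0) = - (l%:R * (y * s l.-1 y 0) - 2 * (y * s l.+1 y 0)).
    have -> : y * c l y 0 = - (l%:R * s l.-1 y 0 - 2 * s l.+1 y 0) by lra.
    by ring.
  by rewrite normrN; exact: b.
have -> : y * (y * s l y 0) = l%:R * (y * c l.-1 y 0) - 2 * (y * c l.+1 y 0).
  have -> : y * s l y 0 = l%:R * c l.-1 y 0 - 2 * c l.+1 y 0 by lra.
  by ring.
exact: b.
Qed.

End gaussian_oscillatory_integrals.

(** * One-dimensional packets: Fourier transform, Schrodinger and heat evolution *)

Section wave_packets.
Context {R : realType}.
Notation mu := (@lebesgue_measure R).
Implicit Types (a b x y t u M L N xi : R) (l m : nat).

Lemma cint_affine a b (G : R -> R[i]) : 0 < a ->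
  continuous (fun x => complex.Re (G x)) ->
  continuous (fun x => complex.Im (G x)) -> cintegrable mu G ->
  cintegrable mu (fun x => G (a * x + b)) /\
  cint mu (fun x => G (a * x + b)) = (a^-1)%:C%C * cint mu G.
Proof.
move=> a0 c1 c2 [i1 i2]; split.
  by split; [exact: (integrable_affine b a0 c1 i1)
            |exact: (integrable_affine b a0 c2 i2)].
apply: complex_ext; rewrite ?ReM ?ImM/= !mul0r ?subr0 ?addr0.
  by rewrite (Rintegral_affine b a0 c1 i1) mulKf// gt_eqF.
by rewrite (Rintegral_affine b a0 c2 i2) mulKf// gt_eqF.
Qed.

Definition cosc_fun l y t x : R[i] :=
  expi (y * x - t * x ^+ 2) * ((x ^+ l * expR (- x ^+ 2))%:C)%C.

Definition cosc l y t : R[i] := (osc (@cos R) l y t +i* osc (@sin R) l y t)%C.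

Lemma Re_cosc_fun l y t x :
  complex.Re (cosc_fun l y t x) = osc_fun (@cos R) l y t x.
Proof. by rewrite /cosc_fun ReM /= /osc_fun mulr0 subr0; ring. Qed.

Lemma Im_cosc_fun l y t x :
  complex.Im (cosc_fun l y t x) = osc_fun (@sin R) l y t x.
Proof. by rewrite /cosc_fun ImM /= /osc_fun mulr0 add0r; ring. Qed.

Lemma cintegrable_cosc_fun l y t : cintegrable mu (cosc_fun l y t).
Proof.
split.
  under [X in EFin \o X]eq_fun do rewrite Re_cosc_fun.
  by apply: integrable_osc_fun; [exact: continuous_cos|exact: cos_max].
under [X in EFin \o X]eq_fun do rewrite Im_cosc_fun.
by apply: integrable_osc_fun; [exact: continuous_sin|exact: sin_max].
Qed.

Lemma cint_cosc_fun l y t : cint mu (cosc_fun l y t) = cosc l y t.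
Proof.
rewrite /cint; congr Complex; apply: eq_Rintegral => x _.
  exact: Re_cosc_fun.
exact: Im_cosc_fun.
Qed.

Lemma cint_cosc_affine l y t a b : 0 < a ->
  cintegrable mu (fun x => cosc_fun l y t (a * x + b)) /\
  cint mu (fun x => cosc_fun l y t (a * x + b)) = (a^-1)%:C%C * cosc l y t.
Proof.
move=> a0; rewrite -cint_cosc_fun; apply: cint_affine => //.
- under [X in continuous X]eq_fun do rewrite Re_cosc_fun.
  exact/continuous_osc_fun/continuous_cos.
- under [X in continuous X]eq_fun do rewrite Im_cosc_fun.
  exact/continuous_osc_fun/continuous_sin.
- exact: cintegrable_cosc_fun.
Qed.

Lemma cosc0 y : cosc 0 y 0 = ((Num.sqrt pi * expR (- (y ^+ 2 / 4)))%:C)%C.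
Proof. by rewrite /cosc osc_cos0 osc_sin0. Qed.

Lemma normc_cosc_pow4 y t : normc (cosc 0 y t) ^+ 4 =
  pi ^+ 2 * expR (- (y ^+ 2 / (1 + t ^+ 2))) / (1 + t ^+ 2).
Proof.
rewrite -osc_norm mulfK; last by rewrite gt_eqF// ltr_pwDl// sqr_ge0.
rewrite (exprM _ 2 2) /normc /cosc sqr_sqrtr//.
by rewrite addr_ge0 ?sqr_ge0.
Qed.

Lemma normc_cosc_le l y : normc (cosc l y 0) <= 2 * osc_bound l / (1 + y ^+ 2).
Proof.
apply: (le_trans (normc_le_ReIm _)).
by have [h1 h2] := osc_decay l y; rewrite -mulrA mulr_natl mulr2n lerD.
Qed.

(** M is the frequency and L the inverse square of the width. The packet is centred at 0, so its
    transform is a real Gaussian around M. *)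
Definition packet M L x : R[i] :=
  expi (M * x) * ((expR (- (L / 2 * x ^+ 2)))%:C)%C.

Definition packet_hat M L xi : R :=
  Num.sqrt (2 * pi / L) * expR (- ((xi - M) ^+ 2 / (2 * L))).

Lemma cint_packet M L xi : 0 < L ->
  cintegrable mu (fun x => expi (- (x * xi)) * packet M L x) /\
  cint mu (fun x => expi (- (x * xi)) * packet M L x) =
    ((packet_hat M L xi)%:C)%C.
Proof.
move=> L0; pose a := Num.sqrt (L / 2).
have L20 : 0 < L / 2 by rewrite divr_gt0.
have a0 : 0 < a by rewrite sqrtr_gt0.
have a2 : a ^+ 2 = L / 2 by rewrite sqr_sqrtr// ltW.
have -> : (fun x => expi (- (x * xi)) * packet M L x) =
    (fun x => cosc_fun 0 ((M - xi) / a) 0 (a * x + 0)).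
  apply/funext => x; rewrite /packet /cosc_fun mulrA -expiD expr0 mul1r addr0.
  congr (expi _ * (expR _)%:C)%C; last by rewrite exprMn a2.
  by field; rewrite gt_eqF.
have [i1 ->] := cint_cosc_affine 0 ((M - xi) / a) 0 0 a0.
split => //; rewrite cosc0 -real_complexM; congr (_%:C)%C.
rewrite mulrA /packet_hat; congr (_ * expR (- _)).
  rewrite /a -sqrtrV ?ltW// -sqrtrM ?invr_ge0 ?ltW//; congr Num.sqrt.
  by field; rewrite gt_eqF.
rewrite expr_div_n a2; field; rewrite gt_eqF//=.
Qed.

(** With xi = M + sqrt(2 L) eta the phase splits into a constant, a linear term carrying the drift x
    - 2 t M (group velocity 2 M), and a quadratic term carrying the dispersion 2 L t. *)
Lemma cint_packet_schrodinger M L x t : 0 < L ->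
  cintegrable mu
    (fun xi => expi (x * xi - t * xi ^+ 2) * ((packet_hat M L xi)%:C)%C) /\
  normc (cint mu
    (fun xi => expi (x * xi - t * xi ^+ 2) * ((packet_hat M L xi)%:C)%C)) =
  2 * Num.sqrt pi *
    normc (cosc 0 ((x - 2 * t * M) * Num.sqrt (2 * L)) (2 * L * t)).
Proof.
move=> L0; pose r := Num.sqrt (2 * L).
have L20 : 0 < 2 * L by rewrite mulr_gt0.
have r0 : 0 < r by rewrite sqrtr_gt0.
have r2 : r ^+ 2 = 2 * L by rewrite sqr_sqrtr// ltW.
pose k : R[i] := expi (x * M - t * M ^+ 2) * ((Num.sqrt (2 * pi / L))%:C)%C.
have -> : (fun xi => expi (x * xi - t * xi ^+ 2) * ((packet_hat M L xi)%:C)%C) =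
    (fun xi => k * cosc_fun 0 ((x - 2 * t * M) * r) (2 * L * t) (r^-1 * xi + - (M / r))).
  apply/funext => xi; rewrite /k /cosc_fun /packet_hat expr0 mul1r.
  rewrite -r2 real_complexM mulrACA -expiD.
  congr (expi _ * (_ * (expR _)%:C))%C.
    by field; rewrite gt_eqF.
  by field; rewrite gt_eqF.
have ri0 : 0 < r^-1 by rewrite invr_gt0.
have [i1 e1] := cint_cosc_affine 0 ((x - 2 * t * M) * r) (2 * L * t) (- (M / r)) ri0.
split; first exact: cintegrableZ.
rewrite cintZ// e1 !normcM normc_expi mul1r !normc_real mulrA; congr (_ * _).
rewrite invrK (gtr0_norm r0) ger0_norm ?sqrtr_ge0// /r -sqrtrM; last first.
  by rewrite divr_ge0 ?mulr_ge0 ?pi_ge0// ltW.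
have -> : 2 * pi / L * (2 * L) = 2 ^+ 2 * pi :> R by field; rewrite gt_eqF.
by rewrite sqrtrM// sqrtr_sqr ger0_norm.
Qed.

(** The exponential is what remains after completing the square. The rational factor is 1 / (1 + 2 L
    x^2 / q) with q = 1 + 2 u L, weakened to q / (1 + 2 L x^2) so that u and x separate. *)
Definition heat_bound M L u x : R :=
  expR (- (u * M ^+ 2 / (1 + 2 * u * L))) * (1 + 2 * u * L) / (1 + 2 * L * x ^+ 2).

(** Comes from the binomial expansion of (c + eta / beta)^m with 0 <= c <= N and 1 / beta <= 2 N:
    the latter gives 2^i, and 2 [osc_bound i] bounds the i-th moment. *)
Definition moment_bound m : R :=
  \sum_(i < m.+1) 2 ^+ i *+ 'C(m, i) * (2 * osc_bound i).

Lemma heat_bound_ge0 M L u x : 0 <= L -> 0 <= u -> 0 <= heat_bound M L u x.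
Proof.
move=> L0 u0; rewrite /heat_bound divr_ge0 ?mulr_ge0 ?expR_ge0//.
  by rewrite addr_ge0// !mulr_ge0.
by rewrite addr_ge0// mulr_ge0 ?sqr_ge0// mulr_ge0.
Qed.

(* Completing the square turns the heat flow of the packet into a Gaussian of
   variance 1/(2 b) centred at c. *)
Lemma cint_packet_heat M L N m x u : 0 < L -> L <= N ^+ 2 -> 0 <= M <= N ->
  1 <= N -> 0 <= u ->
  cintegrable mu (fun xi => ((xi ^+ m)%:C)%C *
    (expi (x * xi) * ((expR (- (u * xi ^+ 2)) * packet_hat M L xi)%:C)%C)) /\
  normc (cint mu (fun xi => ((xi ^+ m)%:C)%C *
    (expi (x * xi) * ((expR (- (u * xi ^+ 2)) * packet_hat M L xi)%:C)%C))) <=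
  2 * Num.sqrt pi * moment_bound m * N ^+ m * heat_bound M L u x.
Proof.
move=> L0 LN /andP[M0 MN] N1 u0.
have N0 : 0 < N by exact: lt_le_trans N1.
pose q := 1 + 2 * u * L.
have q1 : 1 <= q by rewrite lerDl !mulr_ge0// ltW.
have q0 : 0 < q by exact: lt_le_trans q1.
pose b := q / (2 * L); have b0 : 0 < b by rewrite divr_gt0// mulr_gt0.
pose beta := Num.sqrt b; have beta0 : 0 < beta by rewrite sqrtr_gt0.
have beta2 : beta ^+ 2 = b by rewrite sqr_sqrtr// ltW.
pose c := M / q.
have c0 : 0 <= c by rewrite divr_ge0// ltW.
have cN : c <= N by rewrite ler_pdivrMr// (le_trans MN)// ler_peMr// ltW.
(* Two bounds on 1 / beta: this sharp one cancels the L^(-1/2) in the normalisation A, while the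
   crude 2 N serves for the powers of xi. *)
have betaV : beta^-1 <= Num.sqrt (2 * L).
  rewrite /beta -(sqrtrV (ltW b0)); apply: ler_wsqrtr.
  by rewrite /b invf_div ler_pdivrMr// ler_peMr// mulr_ge0// ltW.
have betaN : beta^-1 <= 2 * N.
  apply: (le_trans betaV); rewrite -[leRHS]ger0_norm ?mulr_ge0 ?(ltW N0)//.
  rewrite -sqrtr_sqr; apply: ler_wsqrtr; rewrite exprMn.
  apply: ler_pM => //; first exact: ltW.
  by rewrite expr2 ler_peMr// ler1n.
pose E := expR (- (u * M ^+ 2 / q)).
pose A := Num.sqrt (2 * pi / L).
have A0 : 0 <= A by exact: sqrtr_ge0.
pose w (i : 'I_m.+1) : R := A * E * (c ^+ (m - i) * beta ^- i *+ 'C(m, i)).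
pose F (i : 'I_m.+1) xi : R[i] := (expi (x * c) * ((w i)%:C)%C) *
  cosc_fun i (x / beta) 0 (beta * xi + - (beta * c)).
have -> : (fun xi => ((xi ^+ m)%:C)%C *
    (expi (x * xi) * ((expR (- (u * xi ^+ 2)) * packet_hat M L xi)%:C)%C)) =
    (fun xi => \sum_(i < m.+1) F i xi).
  apply/funext => xi; set eta := beta * xi + - (beta * c).
  have xiE : xi = c + eta / beta by rewrite /eta; field; rewrite gt_eqF.
  have e1 : expi (x * xi) = expi (x * c) * expi (x / beta * eta - 0 * eta ^+ 2).
    by rewrite -expiD; congr expi; rewrite {1}xiE; ring.
  have e2 : expR (- (u * xi ^+ 2)) * packet_hat M L xi = A * E * expR (- eta ^+ 2).
    rewrite /packet_hat /E -/A mulrCA -(mulrA A) -!expRD; congr (_ * expR _).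
    have -> : eta ^+ 2 = b * (xi - c) ^+ 2 by rewrite -beta2 /eta; ring.
    have -> : u = (q - 1) / (2 * L) by rewrite /q; field; rewrite gt_eqF.
    by rewrite /b /c; field; rewrite !gt_eqF.
  rewrite e1 e2 {1}xiE exprDn.
  transitivity (\sum_(i < m.+1) (((c ^+ (m - i) * (eta / beta) ^+ i *+ 'C(m, i))%:C)%C *
      (expi (x * c) * expi (x / beta * eta - 0 * eta ^+ 2) * ((A * E * expR (- eta ^+ 2))%:C)%C))).
    rewrite -mulr_suml; congr (_ * _).
    exact: (big_morph (fun a : R => (a%:C)%C) (@real_complexD R)).
  apply: eq_bigr => i _; rewrite /F /cosc_fun -/eta.
  rewrite [RHS]mulrACA [LHS]mulrCA; congr (_ * _).
  rewrite -!real_complexM; congr (_%:C)%C.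
  rewrite /w (expr_div_n eta) -[X in X * _ = _]mulr_natr.
  rewrite -[X in _ = _ * X * _]mulr_natr.
  move: (c ^+ (m - i)) (eta ^+ i) (beta ^- i) ('C(m, i)%:R : R) (expR (- eta ^+ 2)).
  move=> z1 z2 z3 z4 z5.
  by clearbody A E; ring.
have iF i : cintegrable mu (F i).
  by apply: cintegrableZ; have [] := cint_cosc_affine i (x / beta) 0 (- (beta * c)) beta0.
split; first exact: cintegrable_sum.
rewrite cint_sum//.
have nF i : normc (cint mu (F i)) <= A * E * beta^-1 *
    (N ^+ m * (2 ^+ i *+ 'C(m, i))) * (2 * osc_bound i / (1 + (x / beta) ^+ 2)).
  have [i1 e1] := cint_cosc_affine i (x / beta) 0 (- (beta * c)) beta0.
  rewrite /F cintZ// e1 !normcM normc_expi mul1r !normc_real.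
  rewrite mulrA ler_pM ?mulr_ge0 ?normr_ge0 ?normc_ge0 ?normc_cosc_le//.
  rewrite (gtr0_norm (_ : 0 < beta^-1)) ?invr_gt0// ger0_norm; last first.
    by rewrite /w !mulr_ge0 ?expR_ge0// mulrn_wge0// mulr_ge0 ?invr_ge0 ?exprn_ge0// ltW.
  rewrite /w mulrAC ler_wpM2l ?mulr_ge0 ?expR_ge0 ?invr_ge0 ?(ltW beta0)//.
  rewrite mulrnAr lerMn2r; apply/orP; right.
  have im : (i <= m)%N by rewrite -ltnS.
  have -> : N ^+ m = N ^+ (m - i) * N ^+ i by rewrite -exprD subnK.
  rewrite -mulrA -exprVn ler_pM ?exprn_ge0 ?invr_ge0 ?(ltW beta0)//.
    by rewrite lerXn2r ?nnegrE// ltW.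
  by rewrite -exprMn (mulrC N) lerXn2r ?nnegrE ?mulr_ge0 ?invr_ge0// ltW.
have D0 : 0 < 1 + (x / beta) ^+ 2 by rewrite ltr_pwDl// sqr_ge0.
apply: (@le_trans _ _ (\sum_(i < m.+1) A * E * beta^-1 *
    (N ^+ m * (2 ^+ i *+ 'C(m, i))) * (2 * osc_bound i / (1 + (x / beta) ^+ 2)))).
  apply: (@le_trans _ _ (\sum_(i < m.+1) normc (cint mu (F i)))); last exact: ler_sum.
  elim/big_rec2: _ => [|i y1 y2 _ h]; first by rewrite normc0.
  by apply: (le_trans (le_normcD _ _)); rewrite lerD2l.
have -> : \sum_(i < m.+1) A * E * beta^-1 *
    (N ^+ m * (2 ^+ i *+ 'C(m, i))) * (2 * osc_bound i / (1 + (x / beta) ^+ 2)) =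
    (A * beta^-1) * (moment_bound m * N ^+ m * (E / (1 + (x / beta) ^+ 2))).
  rewrite /moment_bound !mulr_suml mulr_sumr.
  by apply: eq_bigr => i _; ring.
have K0 : 0 <= moment_bound m.
  by apply: sumr_ge0 => i _; rewrite mulr_ge0 ?mulrn_wge0 ?exprn_ge0// mulr_ge0// osc_bound_ge0.
have -> : 2 * Num.sqrt pi * moment_bound m * N ^+ m * heat_bound M L u x =
    (2 * Num.sqrt pi) * (moment_bound m * N ^+ m * heat_bound M L u x).
  by rewrite !mulrA.
apply: ler_pM.
- by rewrite mulr_ge0// invr_ge0 ltW.
- by rewrite !mulr_ge0 ?expR_ge0 ?exprn_ge0 ?invr_ge0 ?(ltW D0)// ltW.
- apply: (@le_trans _ _ (A * Num.sqrt (2 * L))); first by rewrite ler_wpM2l.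
  rewrite /A -sqrtrM; last by rewrite divr_ge0 ?mulr_ge0 ?pi_ge0// ltW.
  have -> : 2 * pi / L * (2 * L) = 2 ^+ 2 * pi :> R by field; rewrite gt_eqF.
  by rewrite sqrtrM// sqrtr_sqr ger0_norm.
rewrite -!mulrA ler_wpM2l// ler_wpM2l ?exprn_ge0 ?(ltW N0)// /heat_bound -/q -/E.
rewrite -mulrA ler_wpM2l ?expR_ge0//.
have X0 : 0 < 1 + 2 * L * x ^+ 2.
  by rewrite ltr_pwDl// mulr_ge0 ?sqr_ge0// mulr_ge0// ltW.
rewrite ler_pdivlMr// mulrC ler_pdivrMr//.
rewrite expr_div_n beta2 /b invf_div mulrDr mulr1 lerD//.
by rewrite le_eqVlt; apply/orP; left; apply/eqP; field; rewrite gt_eqF.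
Qed.

End wave_packets.

(** * The Gamma integral over heat times and its damping *)

Section superposition.
Context {R : realType}.
Notation mu := (@lebesgue_measure R).
Implicit Types (a b x y t u v w M L N lam : R) (l m n : nat).

Lemma integrable_even (f F : R -> R) (l : R) : (forall x, 0 <= f x) ->
  continuous f -> (forall x, f (- x) = f x) ->
  (forall x, 0 <= x -> is_derive x 1 F (f x)) ->
  F x @[x --> +oo] --> l -> mu.-integrable setT (EFin \o f).
Proof.
move=> f0 cf ev DF Fl; apply/integrableP; split.
  by apply/measurable_EFinP; exact: continuous_measurable_fun.
under eq_integral do rewrite /= ger0_norm//.
rewrite ge0_symfun_integralT//; last by move=> x /=; rewrite ev.
rewrite (_ : [set x : R | _] = `[0, +oo[%classic); last first.
  by apply/seteqP; split => x/=; rewrite in_itv/= andbT.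
rewrite (@ge0_continuous_FTC2y _ f F 0 l)//.
- by rewrite -EFinB -EFinM ltry.
- exact: continuous_subspaceT.
- by move=> x x0; have [] := DF x (ltW x0).
- apply: cvg_at_right_filter; apply/differentiable_continuous/derivable1_diffP.
  by have [] := DF 0 (lexx _).
- move=> x; rewrite in_itv/= andbT => x0; rewrite derive1E.
  exact: (@derive_val _ _ _ _ _ _ _ (DF x (ltW x0))).
Qed.

Lemma integrable_expR_abs : mu.-integrable setT
  (EFin \o (fun v : R => expR (- `|v|))).
Proof.
have cabs : continuous (fun v : R => expR (- `|v|)).
  by apply: continuous_expRN; exact: norm_continuous.
have ig : (\int[mu]_v `|(expR (- `|v|))%:E| < +oo)%E.
  under eq_integral do rewrite /= ger0_norm ?expR_ge0//.
  rewrite ge0_symfun_integralT//; last by move=> x /=; rewrite normrN.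
  rewrite (_ : [set x : R | _] = `[0, +oo[%classic); last first.
    by apply/seteqP; split => x/=; rewrite in_itv/= andbT.
  have D x : is_derive x 1 (fun v : R => - expR (- v)) (expR (- x)).
    have D1 : is_derive x 1 (fun v : R => - v) (-1) by exact: is_deriveNid.
    apply: (is_derive1_eq (is_derive1Z (-1) (is_derive1_compose (is_derive_expR _) D1))).
      by move=> z; rewrite mulN1r.
    by rewrite mulrN1 mulN1r opprK.
  rewrite (@ge0_continuous_FTC2y _ _ (fun v => - expR (- v)) 0 0)//.
  - by rewrite -EFinB -EFinM ltry.
  - exact: continuous_subspaceT.
  - by rewrite -oppr0; apply: cvgN; exact: cvgr_expR.
  - apply: cvg_at_right_filter; exact: (is_derive_continuous D).
  - move=> x; rewrite in_itv/= andbT => x0; rewrite derive1E gtr0_norm//.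
    exact: (@derive_val _ _ _ _ _ _ _ (D x)).
apply/integrableP; split => //.
by apply/measurable_EFinP; exact: continuous_measurable_fun.
Qed.

Lemma continuous_1Dsqr : continuous (fun x : R => 1 + x ^+ 2).
Proof.
move=> x; apply: (@continuousD _ _ _ (fun=> 1 : R) (fun x : R => x ^+ 2)).
  exact: cvg_cst.
exact: exprn_continuous.
Qed.

Lemma continuous_cauchy : continuous (fun x : R => (1 + x ^+ 2)^-1).
Proof.
move=> x; apply: (@continuousV _ _ (fun x => 1 + x ^+ 2)).
  by rewrite gt_eqF// ltr_pwDl// sqr_ge0.
exact: continuous_1Dsqr.
Qed.

Lemma integrable_cauchy : mu.-integrable setT
  (EFin \o (fun x : R => (1 + x ^+ 2)^-1)).
Proof.
apply: (integrable_even _ continuous_cauchy _ _ (@cvgy_atan R)).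
- by move=> x; rewrite invr_ge0 addr_ge0// sqr_ge0.
- by move=> x; rewrite sqrrN.
Qed.

(** The Gamma integrand u^(a-1) e^(-u) after u = e^v, so [gamma_const a] is Gamma(a). In logarithmic
    time, rescaling u is a translation of the whole line, which [Rintegral_affine] covers. *)
Definition gamma_fun a v : R := expR (a * v) * expR (- expR v).

Definition gamma_const a : R := Rintegral mu setT (gamma_fun a).

Lemma continuous_gamma_fun a : continuous (gamma_fun a).
Proof.
move=> v; apply: (@continuousM _ _ (fun v => expR (a * v))).
  apply: continuous_comp; last exact: continuous_expR.
  exact: mulrl_continuous.
by apply: continuous_expRN; exact: continuous_expR.
Qed.

(** The exponent a >= 1 gives the decay at minus infinity, the excess J - a >= 1 the decay at plus
    infinity. *)
Lemma expR_1DexpR_le a v (J : nat) : 1 <= a -> a + 1 <= J%:R ->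
  expR (a * v) * (1 + expR v) ^- J <= expR (- `|v|).
Proof.
move=> a1 aJ; have e0 := expR_gt0 v.
have p0 : 0 < 1 + expR v by rewrite addr_gt0.
have [v0|v0] := leP 0 v.
  rewrite ger0_norm//; apply: (@le_trans _ _ (expR (a * v) * expR v ^- J)).
    rewrite ler_wpM2l ?expR_ge0// lef_pV2 ?posrE ?exprn_gt0//.
    by rewrite lerXn2r ?nnegrE ?(ltW e0) ?(ltW p0)// lerDr.
  rewrite -expRM_natl -expRN -expRD ler_expR -mulrBl -[leRHS]mulN1r ler_wpM2r//.
  by lra.
rewrite ltr0_norm// opprK; apply: (@le_trans _ _ (expR (a * v))).
  rewrite ler_piMr ?expR_ge0// invf_le1 ?exprn_gt0// exprn_ege1//.
  by rewrite lerDl ltW.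
by rewrite ler_expR ler_neMl// ltW.
Qed.

Lemma expRN_le (J : nat) (z : R) : 0 <= z ->
  expR (- z) <= J`!%:R * expR 1 * (1 + z) ^- J.
Proof.
move=> z0; have p0 : 0 < 1 + z by rewrite ltr_pwDl.
rewrite ler_pdivlMr ?exprn_gt0// expRN mulrC ler_pdivrMr ?expR_gt0//.
by rewrite -mulrA -expRD exp_ge_pow// ltW.
Qed.

Lemma exists_nat_ge a : exists J : nat, a <= J%:R.
Proof.
exists (Num.truncn `|a|).+1; apply: (le_trans (ler_norm _)); apply: ltW.
exact: truncnS_gt.
Qed.

Lemma integrable_gamma_fun a : 1 <= a -> mu.-integrable setT (EFin \o gamma_fun a).
Proof.
move=> a1; have [J aJ] := exists_nat_ge (a + 1).
apply: integrable_le (integrable_mull (J`!%:R * expR 1) integrable_expR_abs).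
  by apply: continuous_measurable_fun; exact: continuous_gamma_fun.
move=> v; rewrite ger0_norm ?mulr_ge0 ?expR_ge0//.
apply: (@le_trans _ _ (J`!%:R * expR 1 * (expR (a * v) * (1 + expR v) ^- J))).
  rewrite [leRHS]mulrCA ler_wpM2l ?expR_ge0//.
  exact/expRN_le/expR_ge0.
by rewrite ler_wpM2l ?mulr_ge0 ?expR_ge0//; exact: expR_1DexpR_le.
Qed.

Lemma gamma_const_gt0 a : 1 <= a -> 0 < gamma_const a.
Proof.
(* A lower bound of the integrand on [0, 1], an interval of length 1. *)
move=> a1; pose k : R := expR (- expR 1).
have iI : mu.-integrable setT (EFin \o (fun v : R => k * \1_(`[0, 1]%classic : set R) v)).
  by apply: integrable_mull; exact: integrable_indic_itv.
apply: (@lt_le_trans _ _ (Rintegral mu setT (fun v : R => k * \1_(`[0, 1]%classic : set R) v))).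
  rewrite RintegralZl//; last exact: integrable_indic_itv.
  have m1 : (mu `[0%R, 1%R]%classic = 1)%E.
    by rewrite lebesgue_measure_itv/= lte_fin ltr01 oppr0 adde0.
  rewrite /Rintegral integral_indic// setIT [X in fine X](_ : _ = 1%E); last exact: m1.
  by rewrite mulr1 expR_gt0.
apply: le_Rintegral => //; first exact: integrable_gamma_fun.
move=> v _; rewrite indicE; case: (boolP (v \in _)); last first.
  by move=> _; rewrite mulr0 mulr_ge0 ?expR_ge0.
rewrite inE/= in_itv/= => /andP[v0 v1]; rewrite mulr1 /k /gamma_fun.
rewrite -[leLHS]mul1r ler_pM ?expR_ge0//.
  by rewrite -expR0 ler_expR mulr_ge0// (le_trans _ a1).
by rewrite ler_expR lerN2 ler_expR.
Qed.

Definition gamma_kernel a lam v : R := expR (a * v) * expR (- (expR v * lam)).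

Lemma gamma_kernelE a lam v : 0 < lam ->
  gamma_kernel a lam v = lam `^ (- a) * gamma_fun a (1 * v + ln lam).
Proof.
move=> l0; rewrite /gamma_kernel /gamma_fun mul1r expRD lnK ?posrE// mulrA.
congr (_ * _); rewrite mulrDr expRD [a * ln _]mulrC (expRM (ln lam)) lnK ?posrE//.
by rewrite mulrCA powRN mulVf ?mulr1// gt_eqF// powR_gt0.
Qed.

Lemma Rintegral_gamma_kernel a lam : 1 <= a -> 0 < lam ->
  mu.-integrable setT (EFin \o gamma_kernel a lam) /\
  Rintegral mu setT (gamma_kernel a lam) = gamma_const a * lam `^ (- a).
Proof.
move=> a1 l0; have ig := integrable_gamma_fun a1.
have ig1 := integrable_affine (ln lam) ltr01 (@continuous_gamma_fun a) ig.
have -> : gamma_kernel a lam = (fun v => lam `^ (- a) * gamma_fun a (1 * v + ln lam)).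
  by apply/funext => v; exact: gamma_kernelE.
split; first exact: integrable_mull.
rewrite (RintegralZl _ measurableT ig1) /gamma_const.
by rewrite (Rintegral_affine (ln lam) ltr01 (@continuous_gamma_fun a) ig) mul1r mulrC.
Qed.

(* The symbol at frequency |xi| ~ N sits at heat time u = w / N^2 with w ~ 1;
   both for w <= N and for w >= N the total damping E dominates w^(1/3). *)
Lemma heat_damping_le N w : 1 <= N -> 0 <= w ->
  (1 + w) / 3 <= (1 + (w / N ^+ 2 + w / (1 + 2 * w / N))) ^+ 3.
Proof.
move=> N1 w0; have N0 : 0 < N by exact: lt_le_trans N1.
have d0 : 0 < 1 + 2 * w / N.
  by rewrite ltr_pwDl// divr_ge0 ?mulr_ge0// ltW.
have A0 : 0 <= w / N ^+ 2 by rewrite divr_ge0 ?exprn_ge0// ltW.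
have B0 : 0 <= w / (1 + 2 * w / N) by rewrite divr_ge0// ltW.
have [wN|Nw] := leP w N.
  have B : w / 3 <= w / (1 + 2 * w / N).
    rewrite ler_wpM2l// lef_pV2 ?posrE//.
    have : w / N <= 1 by rewrite ler_pdivrMr// mul1r.
    by rewrite -mulrA; lra.
  apply: (@le_trans _ _ (1 + (w / N ^+ 2 + w / (1 + 2 * w / N)))); first lra.
  by rewrite -[leLHS]expr1 ler_weXn2l// lerDl addr_ge0.
have B : N / 3 <= w / (1 + 2 * w / N).
  rewrite ler_pdivlMr//.
  have -> : N / 3 * (1 + 2 * w / N) = N / 3 + 2 * w / 3 by field; rewrite gt_eqF.
  lra.
set A := w / N ^+ 2 in A0 *; set E := A + _.
have EB : A + N / 3 <= E by rewrite lerD2l.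
have N30 : 0 <= N / 3 by rewrite divr_ge0// ltW.
apply: (@le_trans _ _ ((1 + (A + N / 3)) ^+ 3)); last first.
  by rewrite lerXn2r ?nnegrE ?lerD2l ?addr_ge0.
have wE : w = A * N ^+ 2 by rewrite /A divfK// expf_neq0// gt_eqF.
(* In the expanded cube the mixed term 3 A (N / 3)^2 is exactly w / 3; with the leading 1 it gives
   the claim, and all the other terms are collected here. *)
have h : 0 <= (N / 3) ^+ 3 + A ^+ 3 + 3 * A ^+ 2 * (N / 3) + 3 * (A + N / 3) + 3 * (A + N / 3) ^+ 2.
  by do ![done|apply: addr_ge0|apply: mulr_ge0|apply: exprn_ge0].
have -> : (1 + (A + N / 3)) ^+ 3 = 1 + A * N ^+ 2 / 3 + ((N / 3) ^+ 3 + A ^+ 3 +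
   3 * A ^+ 2 * (N / 3) + 3 * (A + N / 3) + 3 * (A + N / 3) ^+ 2) by field.
by rewrite -wE; lra.
Qed.

(** The dependence on the heat time u = e^v of the Gamma weight times n coordinatewise heat bounds:
    one damping factor from the oscillating coordinate, and n factors 1 + 2 u N^2 for the
    spreading. *)
Definition damped_fun a n N v : R := gamma_fun a v *
  (expR (- (expR v * N ^+ 2 / (1 + 2 * expR v * N))) * (1 + 2 * expR v * N ^+ 2) ^+ n).

(** The first n powers pay for the spreading (1 + 2 w)^n; the others, more than a + 1 in number,
    leave an integrable function by [expR_1DexpR_le]. *)
Definition damped_exp a n : nat := (n + (Num.truncn `|a + 1|%R).+1)%N.

Definition damped_const a n : R := let J := damped_exp a n in
  2 ^+ n * ((3 * J)`!%:R * expR 1 * 3 ^+ J) *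
  Rintegral mu setT (fun v : R => expR (- `|v|)).

(** In the variable w = u N^2, a translation of v by ln(N^2), the factor e^(a v) releases N^(-2 a),
    and what remains is bounded independently of N. This is where the power of N in the Sobolev
    bound arises. *)
Lemma damped_fun_le a n N v : 1 <= a -> 1 <= N ->
  damped_fun a n N v <= N `^ (- (2 * a)) *
    (2 ^+ n * ((3 * damped_exp a n)`!%:R * expR 1 * 3 ^+ damped_exp a n) *
     expR (- `|1 * v + ln (N ^+ 2)|)).
Proof.
set J := damped_exp a n; move=> a1 N1; have N0 : 0 < N by exact: lt_le_trans N1.
set v' := 1 * v + _; pose w := expR v'.
have w0 : 0 < w by exact: expR_gt0.
have uE : expR v = w / N ^+ 2.
  rewrite /w /v' mul1r expRD lnK ?posrE ?exprn_gt0// mulfK//.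
  by rewrite expf_neq0// gt_eqF.
have e1 : expR (a * v) = N `^ (- (2 * a)) * expR (a * v').
  rewrite /v' mul1r mulrDr expRD mulrCA [a * ln _]mulrC (expRM (ln _)) lnK ?posrE ?exprn_gt0//.
  rewrite -powR_mulrn ?(ltW N0)// -powRrM powRN mulVf ?mulr1// gt_eqF// powR_gt0//.
rewrite /damped_fun /gamma_fun e1 -[leLHS]mulrA -[leLHS]mulrA ler_wpM2l ?powR_ge0//.
pose E := w / N ^+ 2 + w / (1 + 2 * w / N).
have E0 : 0 <= E.
  by rewrite addr_ge0// divr_ge0 ?addr_ge0 ?divr_ge0 ?mulr_ge0 ?exprn_ge0// ltW.
have -> : expR (- expR v) * (expR (- (expR v * N ^+ 2 / (1 + 2 * expR v * N))) *
    (1 + 2 * expR v * N ^+ 2) ^+ n) = expR (- E) * (1 + 2 * w) ^+ n.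
  rewrite mulrA -expRD uE -[2 * _ * N ^+ 2]mulrA divfK ?expf_neq0 ?gt_eqF//.
  congr (expR _ * _).
  rewrite /E; field; rewrite !gt_eqF ?addr_gt0 ?mulr_gt0//.
have p0 : 0 < 1 + w by rewrite addr_gt0.
(* The order 3 J compensates the cube in [heat_damping_le], and 3^J its division by 3. *)
have EJ : expR (- E) <= (3 * J)`!%:R * expR 1 * 3 ^+ J * (1 + w) ^- J.
  apply: (le_trans (expRN_le (3 * J) E0)); rewrite -[leRHS]mulrA ler_wpM2l ?mulr_ge0 ?expR_ge0//.
  have -> : 3 ^+ J * (1 + w) ^- J = (((1 + w) / 3) ^+ J)^-1.
    by rewrite expr_div_n invf_div.
  have E1 : 0 < 1 + E by rewrite ltr_pwDl.
  have h := heat_damping_le N1 (ltW w0).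
  have w3 : 0 < (1 + w) / 3 by rewrite divr_gt0.
  rewrite exprM lef_pV2 ?posrE ?exprn_gt0//.
  by rewrite lerXn2r ?nnegrE ?exprn_ge0 ?(ltW w3) ?(ltW E1).
have wn : (1 + 2 * w) ^+ n <= 2 ^+ n * (1 + w) ^+ n.
  rewrite -exprMn lerXn2r ?nnegrE ?mulr_ge0 ?addr_ge0 ?mulr_ge0 ?(ltW w0)//.
  by rewrite mulrDr mulr1 lerD2r ler1n.
set K := (3 * J)`!%:R * expR 1 * 3 ^+ J in EJ *.
have K0 : 0 <= K by rewrite !mulr_ge0 ?expR_ge0 ?exprn_ge0.
apply: (@le_trans _ _ (expR (a * v') * ((K * (1 + w) ^- J) * (2 ^+ n * (1 + w) ^+ n)))).
  rewrite ler_wpM2l ?expR_ge0// ler_pM ?expR_ge0// exprn_ge0// addr_ge0// mulr_ge0//.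
  exact: ltW.
have -> : expR (a * v') * (K * (1 + w) ^- J * (2 ^+ n * (1 + w) ^+ n)) =
    2 ^+ n * (K * (expR (a * v') * (1 + w) ^- (Num.truncn `|a + 1|%R).+1)).
  rewrite {1}/J /damped_exp exprD invfM; set X := (1 + w) ^+ n; set Y := (1 + w) ^+ _.
  have X0 : X != 0 by rewrite expf_neq0// gt_eqF.
  have Y0 : Y != 0 by rewrite expf_neq0// gt_eqF.
  by clearbody X Y K; field; rewrite X0 Y0.
rewrite -[leRHS]mulrA ler_wpM2l ?exprn_ge0// ler_wpM2l//; apply: expR_1DexpR_le => //.
by apply: (le_trans (ler_norm _)); apply: ltW; exact: truncnS_gt.
Qed.

Lemma continuous_damped_fun a n N : 0 <= N -> continuous (damped_fun a n N).
Proof.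
move=> N0; have cq k c : 0 <= c -> continuous (fun v : R => 1 + k * expR v * c).
  move=> c0 v; apply: (@continuousD _ _ _ (fun=> 1 : R) (fun v : R => k * expR v * c)).
    exact: cvg_cst.
  apply: (@continuousM _ _ (fun v => k * expR v) (fun=> c)); last exact: cvg_cst.
  apply: (@continuousM _ _ (fun=> k)); first exact: cvg_cst.
  exact: continuous_expR.
move=> v; apply: (@continuousM _ _ (gamma_fun a)); first exact: continuous_gamma_fun.
apply: (@continuousM _ _ (fun v => expR (- (expR v * N ^+ 2 / (1 + 2 * expR v * N))))).
  apply: (@continuous_expRN _ (fun v => expR v * N ^+ 2 / (1 + 2 * expR v * N))).
  move=> {}v; apply: (@continuousM _ _ (fun v => expR v * N ^+ 2) (fun v => (1 + 2 * expR v * N)^-1)).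
    apply: (@continuousM _ _ expR (fun=> N ^+ 2)); last exact: cvg_cst.
    exact: continuous_expR.
  apply: (@continuousV _ _ (fun v => 1 + 2 * expR v * N)); last exact: cq.
  by rewrite gt_eqF// ltr_pwDl// !mulr_ge0 ?expR_ge0.
apply: (@continuous_comp _ _ _ (fun v => 1 + 2 * expR v * N ^+ 2) (fun x => x ^+ n)).
  exact/cq/exprn_ge0.
exact: exprn_continuous.
Qed.

Lemma Rintegral_damped_fun_le a n N : 1 <= a -> 1 <= N ->
  mu.-integrable setT (EFin \o damped_fun a n N) /\
  Rintegral mu setT (damped_fun a n N) <= damped_const a n * N `^ (- (2 * a)).
Proof.
move=> a1 N1; have N0 : 0 < N by exact: lt_le_trans N1.
have cE : continuous (fun v : R => expR (- `|v|)).
  by apply: continuous_expRN; exact: norm_continuous.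
have iE := integrable_expR_abs.
have iE1 := integrable_affine (ln (N ^+ 2)) ltr01 cE iE.
have iE2 := integrable_mull (N `^ (- (2 * a))) (integrable_mull (2 ^+ n *
  ((3 * damped_exp a n)`!%:R * expR 1 * 3 ^+ damped_exp a n)) iE1).
have g0 v : 0 <= damped_fun a n N v.
  rewrite !mulr_ge0 ?expR_ge0 ?exprn_ge0 ?addr_ge0 ?mulr_ge0 ?expR_ge0 ?exprn_ge0 ?(ltW N0)//.
have ig : mu.-integrable setT (EFin \o damped_fun a n N).
  apply: integrable_le iE2.
    by apply: continuous_measurable_fun; exact/continuous_damped_fun/ltW.
  by move=> v; rewrite ger0_norm//; exact: damped_fun_le.
split => //; apply: le_trans (le_Rintegral measurableT ig iE2 _) _.
  by move=> v _; exact: damped_fun_le.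
rewrite (RintegralZl _ measurableT (integrable_mull _ iE1)).
rewrite (RintegralZl _ measurableT iE1) mulrC /damped_const.
by rewrite (Rintegral_affine (ln (N ^+ 2)) ltr01 cE iE) mul1r.
Qed.

End superposition.

(** * Packets on R^n and polynomial multipliers *)

Section row_packets.
Context {R : realType}.
Notation mu := (@lebesgue_measure R).

Definition japanese n (xi : 'rV[R]_n) : R := 1 + \sum_(j < n) xi ord0 j ^+ 2.

Lemma japanese_ge1 n (xi : 'rV[R]_n) : 1 <= japanese xi.
Proof. by rewrite lerDl sumr_ge0// => j _; exact: sqr_ge0. Qed.

Lemma enorm_sqr n (xi : 'rV[R]_n) : 1 + enorm xi ^+ 2 = japanese xi.
Proof.
rewrite /enorm sqr_sqrtr; last by apply: sumr_ge0 => j _; exact: sqr_ge0.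
by congr (_ + _); apply: eq_bigr => j _; rewrite expr2.
Qed.

Lemma measurable_japanese n : measurable_fun [set: 'rV[R]_n] (@japanese n).
Proof.
apply: measurable_funD; first exact: measurable_cst.
apply: measurable_sum => j; apply: measurable_funX.
exact: (measurable_row_coord j).
Qed.

(** Multiplying a tensor by 1 + sum_i xi_i^2 gives n + 1 tensors, each with at most one exponent
    raised by 2. Since N >= 1, each costs at most N^2, whence (n + 1)^k N^(2 k). The exponents e
    vary in the induction on k, and D caps the moments that are used. *)
Lemma cint_japanese_tensor n (h : 'I_n -> R -> R[i]) (B : 'I_n -> R) (K N : R)
    (D : nat) : 1 <= N -> 0 <= K -> (forall j, 0 <= B j) ->
  (forall j m, (m <= D)%N ->
    cintegrable mu (fun xi => ((xi ^+ m)%:C)%C * h j xi) /\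
    normc (cint mu (fun xi => ((xi ^+ m)%:C)%C * h j xi)) <= K * N ^+ m * B j) ->
  forall k (e : 'I_n -> nat), (forall j, e j + 2 * k <= D)%N ->
  cintegrable (lebesgue_row R n) (fun xi => ((japanese xi ^+ k)%:C)%C *
    \prod_j (((xi ord0 j ^+ e j)%:C)%C * h j (xi ord0 j))) /\
  normc (cint (lebesgue_row R n) (fun xi => ((japanese xi ^+ k)%:C)%C *
    \prod_j (((xi ord0 j ^+ e j)%:C)%C * h j (xi ord0 j)))) <=
  n.+1%:R ^+ k * K ^+ n * N ^+ (2 * k + \sum_j e j) * \prod_j B j.
Proof.
move=> N1 K0 Bge0 H; have N0 : 0 <= N by exact: le_trans N1.
elim=> [|k IHk] e eD.
  have eD0 j : (e j <= D)%N by rewrite -[e j]addn0; exact: eD.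
  pose F j xi := ((xi ^+ e j)%:C)%C * h j xi.
  have iF j : cintegrable mu (F j) by have [] := H j _ (eD0 j).
  have [i1 e1] := cint_tensor iF.
  have -> : (fun xi : 'rV[R]_n => ((japanese xi ^+ 0)%:C)%C *
      \prod_j (((xi ord0 j ^+ e j)%:C)%C * h j (xi ord0 j))) =
      (fun xi : 'rV[R]_n => \prod_j F j (xi ord0 j)).
    by apply/funext => xi; rewrite expr0 mul1r.
  split => //; rewrite e1 normc_prod expr0 mul1r muln0 add0n.
  have -> : K ^+ n * N ^+ (\sum_j e j) * \prod_j B j =
      \prod_(j < n) (K * N ^+ e j * B j).
    rewrite !big_split /= prodr_const card_ord; congr (_ * _ * _).
    by rewrite (big_morph (fun i => N ^+ i) (exprD N) (expr0 N)).
  apply: ler_prod => j _; rewrite normc_ge0/=.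
  by have [] := H j _ (eD0 j).
pose G (e : 'I_n -> nat) (xi : 'rV[R]_n) : R[i] := ((japanese xi ^+ k)%:C)%C *
    \prod_j (((xi ord0 j ^+ e j)%:C)%C * h j (xi ord0 j)).
pose e' (i : 'I_n) (j : 'I_n) : nat := (e j + 2 * (j == i))%N.
have eDk j : (e j + 2 * k <= D)%N.
  by apply: leq_trans (eD j); rewrite leq_add2l leq_mul2l leqnSn.
have e'D i j : (e' i j + 2 * k <= D)%N.
  apply: leq_trans (eD j); rewrite /e' -addnA leq_add2l -mulnDr leq_mul2l /=.
  by case: (j == i); rewrite ?add1n ?add0n.
have GE : (fun xi : 'rV[R]_n => ((japanese xi ^+ k.+1)%:C)%C *
    \prod_j (((xi ord0 j ^+ e j)%:C)%C * h j (xi ord0 j))) =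
    (fun xi => G e xi + \sum_(i < n) G (e' i) xi).
  apply/funext => xi; rewrite {1}/G exprS {1}/japanese.
  set P := \prod_j _.
  have GP i : G (e' i) xi = ((xi ord0 i ^+ 2)%:C)%C * (((japanese xi ^+ k)%:C)%C * P).
    rewrite /G [RHS]mulrCA; congr (_ * _).
    rewrite /P (bigD1 i)//= [in RHS](bigD1 i)//= [RHS]mulrA; congr (_ * _).
      rewrite /e' eqxx muln1 exprD real_complexM -!mulrA [RHS]mulrCA.
      by congr (_ * _); rewrite mulrC.
    by apply: eq_bigr => j ji; rewrite /e' (negbTE ji) muln0 addn0.
  have -> : \sum_(i < n) G (e' i) xi =
      (\sum_(i < n) ((xi ord0 i ^+ 2)%:C)%C) * (((japanese xi ^+ k)%:C)%C * P).
    by rewrite mulr_suml; apply: eq_bigr => i _; exact: GP.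
  rewrite real_complexM real_complexD -mulrA mulrDl mul1r; congr (_ + _ * _).
  apply: (big_morph (fun a : R => (a%:C)%C)) => //; exact: real_complexD.
have [iG nG] := IHk e eDk.
have iG' i : cintegrable (lebesgue_row R n) (G (e' i)) by have [] := IHk (e' i) (e'D i).
have nG' i := (IHk (e' i) (e'D i)).2.
rewrite GE; split; first by apply: cintegrableD => //; exact: cintegrable_sum.
rewrite cintD//; last exact: cintegrable_sum.
rewrite cint_sum//.
have B0 : 0 <= \prod_j B j by apply: prodr_ge0 => j _.
set Q := n.+1%:R ^+ k * K ^+ n * N ^+ (2 * k.+1 + \sum_j e j) * \prod_j B j.
have QE a b : (a <= b)%N -> n.+1%:R ^+ k * K ^+ n * N ^+ a * \prod_j B j <=
    n.+1%:R ^+ k * K ^+ n * N ^+ b * \prod_j B j.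
  by move=> ab; rewrite ler_wpM2r// ler_wpM2l ?mulr_ge0 ?exprn_ge0// ler_weXn2l.
have -> : n.+1%:R ^+ k.+1 * K ^+ n * N ^+ (2 * k.+1 + \sum_j e j) * \prod_j B j =
    Q + \sum_(i < n) Q.
  by rewrite sumr_const card_ord -mulrS -[RHS]mulr_natl /Q exprS !mulrA.
apply: (le_trans (le_normcD _ _)); apply: lerD.
  apply: (le_trans nG); apply: QE; rewrite leq_add2r leq_mul2l leqnSn.
  by rewrite orbT.
apply: (@le_trans _ _ (\sum_(i < n) normc (cint (lebesgue_row R n) (G (e' i))))).
  elim/big_rec2: _ => [|i y1 y2 _ hh]; first by rewrite normc0.
  by apply: (le_trans (le_normcD _ _)); rewrite lerD2l.
apply: ler_sum => i _; apply: (le_trans (nG' i)); apply: QE.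
have -> : (\sum_j e' i j = 2 + \sum_j e j)%N.
  rewrite /e' big_split/= addnC; congr addn.
  by rewrite (bigD1 i)//= eqxx big1 => [|j /negbTE ->].
by rewrite addnCA addnA mulnS.
Qed.

Section packet_family.
Variable m : nat.
Implicit Types (N t s a : R) (x xi : 'rV[R]_m.+1) (j : 'I_m.+1).

Definition freq N j : R := if j == ord0 then N else 0.
Definition curv N j : R := if j == ord0 then N else N ^+ 2.

Definition row_packet N x : R[i] :=
  \prod_j packet (freq N j) (curv N j) (x ord0 j).

Definition row_packet_hat N xi : R :=
  \prod_j packet_hat (freq N j) (curv N j) (xi ord0 j).

Lemma curv_gt0 N j : 0 < N -> 0 < curv N j.
Proof. by rewrite /curv; case: ifP => // _ N0; rewrite exprn_gt0. Qed.

Lemma curv_le N j : 1 <= N -> curv N j <= N ^+ 2.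
Proof.
by rewrite /curv; case: ifP => // _ N1; rewrite expr2 ler_peMr// (le_trans _ N1).
Qed.

Lemma freq_itv N j : 1 <= N -> 0 <= freq N j <= N.
Proof.
by move=> N1; rewrite /freq; case: ifP => // _; rewrite lexx (le_trans _ N1).
Qed.

Lemma fourier_row_packet N xi : 1 <= N ->
  fourier (row_packet N) xi = ((row_packet_hat N xi)%:C)%C.
Proof.
move=> N1; have N0 : 0 < N by exact: lt_le_trans N1.
pose F j z := expi (- (z * xi ord0 j)) * packet (freq N j) (curv N j) z.
have F1 j := cint_packet (freq N j) (xi ord0 j) (curv_gt0 j N0).
have [_ e] := cint_tensor (fun j => (F1 j).1 : cintegrable mu (F j)).
rewrite /fourier.
have -> : (fun x => expi (- dot x xi) * row_packet N x) =
    (fun x => \prod_j F j (x ord0 j)).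
  apply/funext => x; rewrite /F big_split /=; congr (_ * _).
  by rewrite /dot -sumrN expi_sum.
rewrite -[cintegral _]/(cint (lebesgue_row R m.+1) _) e /row_packet_hat.
by rewrite real_complex_prod; apply: eq_bigr => j _; exact: (F1 j).2.
Qed.

Lemma normc_schrodinger_row_packet N t x : 1 <= N ->
  normc (schrodinger t (row_packet N) x) = (2 * pi) ^- m.+1 *
    \prod_j (2 * Num.sqrt pi *
      normc (cosc 0 ((x ord0 j - 2 * t * freq N j) * Num.sqrt (2 * curv N j))
                    (2 * curv N j * t))).
Proof.
move=> N1; have N0 : 0 < N by exact: lt_le_trans N1.
pose F j z := expi (x ord0 j * z - t * z ^+ 2) *
  ((packet_hat (freq N j) (curv N j) z)%:C)%C.
have F1 j := cint_packet_schrodinger (freq N j) (x ord0 j) t (curv_gt0 j N0).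
have [_ e] := cint_tensor (fun j => (F1 j).1 : cintegrable mu (F j)).
rewrite /schrodinger normcM normc_real.
rewrite ger0_norm; last by rewrite invr_ge0 exprn_ge0// mulr_ge0 ?pi_ge0.
congr (_ * _).
have -> : (fun xi => expi (dot x xi - t * enorm xi ^+ 2) * fourier (row_packet N) xi) =
    (fun xi => \prod_j F j (xi ord0 j)).
  apply/funext => xi; rewrite /F big_split /= fourier_row_packet//.
  rewrite /row_packet_hat real_complex_prod; congr (_ * _).
  rewrite -expi_sum big_split /= /dot sumrN -mulr_sumr; congr (expi (_ - _ * _)).
  by have := enorm_sqr xi; rewrite /japanese => /addrI.
rewrite -[cintegral _]/(cint (lebesgue_row R m.+1) _) e normc_prod.
by apply: eq_bigr => j _; exact: (F1 j).2.
Qed.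

End packet_family.
End row_packets.

(** * Pointwise bounds: evolution from below, Bessel potential from above *)

Section packet_bounds.
Context {R : realType} (m : nat).
Notation mu := (@lebesgue_measure R).
Implicit Types (N t s a u v : R) (x xi : 'rV[R]_m.+1) (j : 'I_m.+1).

(** On the box, |x|^2 <= 9/16 + 1/4 < 1. Since x_0 stays away from 0, the time x_0 / (2 N) is
    comparable to 1/N, and the other sides are short enough for |x_j| <= x_0. *)
Definition slab j : set R :=
  if j == ord0 then `[1 / 2, 3 / 4]%classic else `[0, (2 * m.+1%:R)^-1]%classic.

Definition packet_box : set 'rV[R]_m.+1 := [set x | forall j, slab j (x ord0 j)].

Lemma packet_box0 x : packet_box x -> 1 / 2 <= x ord0 ord0 <= 3 / 4.
Proof. by move=> /(_ ord0); rewrite /slab eqxx /= in_itv. Qed.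

Lemma packet_boxS x j : packet_box x -> j != ord0 ->
  0 <= x ord0 j <= (2 * m.+1%:R)^-1.
Proof. by move=> /(_ j); rewrite /slab => /[swap] /negbTE -> /=; rewrite in_itv. Qed.

Lemma packet_boxS_sqr x j : packet_box x -> j != ord0 ->
  x ord0 j ^+ 2 <= (4 * m.+1%:R)^-1.
Proof.
move=> bx j0; have /andP[xj0 xj] := packet_boxS bx j0.
apply: (@le_trans _ _ ((2 * m.+1%:R)^-1 ^+ 2)).
  by rewrite lerXn2r ?nnegrE ?invr_ge0 ?mulr_ge0.
rewrite exprVn exprMn lef_pV2 ?posrE ?mulr_gt0 ?exprn_gt0 ?ltr0n//.
by rewrite -natrX ler_pM2l// expr2 ler_peMr// ler1n.
Qed.

Lemma packet_box_unit_ball : packet_box `<=` unit_ball.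
Proof.
move=> x bx; rewrite /unit_ball/= /enorm -[ltRHS]sqrtr1 ltr_sqrt//.
rewrite /dot big_ord_recl -expr2.
have /andP[x1 x2] := packet_box0 bx.
have h : \sum_(i < m) x ord0 (lift ord0 i) * x ord0 (lift ord0 i) <= 1 / 4.
  apply: (@le_trans _ _ (\sum_(i < m) (4 * m.+1%:R)^-1)).
    by apply: ler_sum => i _; rewrite -expr2; exact: packet_boxS_sqr.
  rewrite sumr_const card_ord -[leLHS]mulr_natl ler_pdivrMr ?mulr_gt0 ?ltr0n//.
  have : m%:R <= m.+1%:R :> R by rewrite ler_nat.
  lra.
nra.
Qed.

Definition box_volume : R :=
  \prod_(j < m.+1) (if j == ord0 then 1 / 4 else (2 * m.+1%:R)^-1).

Lemma box_volume_gt0 : 0 < box_volume.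
Proof.
by apply: prodr_gt0 => j _; case: ifP; rewrite ?divr_gt0 ?invr_gt0 ?mulr_gt0 ?ltr0n.
Qed.

Lemma lebesgue_row_packet_box : lebesgue_row R m.+1 packet_box = box_volume%:E.
Proof.
rewrite /packet_box (lebesgue_row_box (A := slab)); last first.
  by move=> j; rewrite /slab; case: ifP => _; exact: measurable_itv.
rewrite /box_volume (big_morph _ (@EFinM R) erefl).
apply: eq_bigr => j _; rewrite /slab; case: ifP => _.
  rewrite lebesgue_measure_itv/= lte_fin ifT; last lra.
  by rewrite -EFinB; congr EFin; lra.
rewrite lebesgue_measure_itv/= lte_fin invr_gt0 mulr_gt0 ?ltr0n//.
by rewrite oppr0 adde0.
Qed.

Lemma normc_cosc_ge (y t z : R) : 0 <= z ->
  z ^+ 4 <= pi ^+ 2 * expR (- (y ^+ 2 / (1 + t ^+ 2))) / (1 + t ^+ 2) ->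
  z <= normc (cosc 0 y t).
Proof.
by move=> z0; rewrite -normc_cosc_pow4 ler_pXn2r// nnegrE ?normc_ge0.
Qed.

Definition lower_const : R :=
  (2 * pi) ^- m.+1 * (2 * Num.sqrt pi * expR (- 1)) ^+ m.+1.

Lemma lower_const_gt0 : 0 < lower_const.
Proof.
by rewrite mulr_gt0 ?invr_gt0 ?exprn_gt0 ?mulr_gt0 ?expR_gt0 ?sqrtr_gt0 ?pi_gt0.
Qed.

(* At time x_0 / (2 N) the packet, moving with velocity 2 N along the first
   axis, is centred at x_0 in that variable, and has spread over the unit scale
   in the other ones. *)
Lemma schrodinger_row_packet_ge N x : 1 <= N -> packet_box x ->
  exists2 t : R, t \in `]0, 1[ &
    lower_const * Num.sqrt N ^- m <= normc (schrodinger t (row_packet N) x).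
Proof.
move=> N1 bx; have N0 : 0 < N by exact: lt_le_trans N1.
have /andP[x1 x2] := packet_box0 bx; set x0 := x ord0 ord0 in x1 x2.
have x00 : 0 < x0 by lra.
exists (x0 / (2 * N)).
  rewrite in_itv/= divr_gt0 ?mulr_gt0//= ltr_pdivrMr ?mulr_gt0//; lra.
rewrite normc_schrodinger_row_packet//.
rewrite /lower_const -[leLHS]mulrA ler_wpM2l ?invr_ge0 ?exprn_ge0 ?mulr_ge0 ?pi_ge0//.
have -> : (2 * Num.sqrt pi * expR (- 1)) ^+ m.+1 / Num.sqrt N ^+ m =
    \prod_(j < m.+1) (2 * Num.sqrt pi *
      (expR (- 1) * (if j == ord0 then 1 else (Num.sqrt N)^-1))).
  rewrite -exprVn big_ord_recl /= mulr1 prodr_const card_ord.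
  by rewrite [X in _ = _ * X ^+ _]mulrA [X in _ = _ * X]exprMn exprS !mulrA.
have pi2 : 2 <= pi :> R by exact: pi_ge2.
have pisq : 4 <= pi ^+ 2 :> R by nra.
have e4 : expR (- 1) ^+ 4 = expR (- 4) :> R.
  by rewrite -expRM_natl mulrN1.
have s0 : 0 <= Num.sqrt N by exact: sqrtr_ge0.
have xx : x0 ^+ 2 <= 1 by nra.
apply: ler_prod => j _.
have z0 : 0 <= expR (- 1) * (if j == ord0 then 1 else (Num.sqrt N)^-1) :> R.
  by case: ifP => _; rewrite mulr_ge0 ?expR_ge0 ?invr_ge0.
have c0 : 0 <= 2 * Num.sqrt pi :> R by rewrite mulr_ge0 ?sqrtr_ge0.
apply/andP; split; first exact: mulr_ge0.
apply: ler_wpM2l => //; apply: normc_cosc_ge => //.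
rewrite /freq /curv; have [->|j0] := eqVneq j ord0.
  have -> : (x ord0 ord0 - 2 * (x0 / (2 * N)) * N) * Num.sqrt (2 * N) = 0.
    by apply/eqP; rewrite mulf_eq0; apply/orP; left; apply/eqP; rewrite -/x0; field; rewrite gt_eqF.
  have -> : 2 * N * (x0 / (2 * N)) = x0 by field; rewrite gt_eqF.
  rewrite mulr1 e4 expr0n/= mul0r oppr0 expR0 mulr1.
  apply: (@le_trans _ _ 1); first by rewrite -[leRHS]expR0 ler_expR; lra.
  by rewrite ler_pdivlMr ?ltr_pwDl ?sqr_ge0//; lra.
(* A transverse variable has dispersion N x_0, so the fourth power of the modulus carries 1 / (1 +
   N^2 x_0^2), of size N^(-2): each such variable costs N^(-1/2). *)
have -> : 2 * N ^+ 2 * (x0 / (2 * N)) = N * x0 by field; rewrite gt_eqF.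
rewrite mulr0 subr0 !exprMn e4 sqr_sqrtr; last by rewrite mulr_ge0 ?exprn_ge0// ltW.
rewrite exprVn (exprM _ 2 2) sqr_sqrtr ?(ltW N0)//.
have D0 : 0 < 1 + N ^+ 2 * x0 ^+ 2 by rewrite ltr_pwDl// mulr_ge0// sqr_ge0.
have xj : x ord0 j ^+ 2 <= x0 ^+ 2.
  have := packet_boxS_sqr bx j0.
  have : (4 * m.+1%:R)^-1 <= 1 / 4 :> R.
    by rewrite invfM mul1r ler_piMr// invf_le1 ?ltr0n// ler1n.
  have h1 : 1 / 4 <= x0 ^+ 2 by nra.
  by move=> h2 h3; exact: le_trans h3 (le_trans h2 h1).
(* The Gaussian exponent stays bounded because |x_j| <= x_0; the value 4 fits the factor exp(-1) per
   coordinate in [lower_const], as fourth powers are compared. *)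
have q : x ord0 j ^+ 2 * (2 * N ^+ 2) / (1 + N ^+ 2 * x0 ^+ 2) <= 4.
  rewrite ler_pdivrMr//.
  have : x ord0 j ^+ 2 * N ^+ 2 <= x0 ^+ 2 * N ^+ 2 by rewrite ler_wpM2r// sqr_ge0.
  have : 0 <= x0 ^+ 2 * N ^+ 2 by rewrite mulr_ge0 ?sqr_ge0.
  lra.
rewrite mulrC [leRHS]mulrAC ler_pM ?expR_ge0 ?invr_ge0 ?sqr_ge0//.
  rewrite ler_pdivlMr// ler_pdivrMl ?exprn_gt0//.
  have : N ^+ 2 * x0 ^+ 2 <= N ^+ 2 by rewrite ler_piMr// sqr_ge0.
  have : 1 <= N ^+ 2 by rewrite exprn_ege1.
  have : 4 * N ^+ 2 <= N ^+ 2 * pi ^+ 2 by rewrite mulrC ler_wpM2l// sqr_ge0.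
  lra.
by rewrite ler_expR lerN2.
Qed.

(** The part of the product of heat bounds that is free of u: a rational envelope with the scales of
    the packet, in place of its Gaussian profile. *)
Definition packet_weight N x : R :=
  \prod_j (1 + 2 * curv N j * x ord0 j ^+ 2)^-1.

Lemma curv_term_gt0 N j z : 0 < N -> 0 < 1 + 2 * curv N j * z ^+ 2.
Proof.
by move=> N0; rewrite ltr_pwDl// mulr_ge0 ?sqr_ge0// mulr_ge0// ltW// curv_gt0.
Qed.

Lemma packet_weight_itv N x : 0 < N -> 0 <= packet_weight N x <= 1.
Proof.
move=> N0; have h j : 0 <= (1 + 2 * curv N j * x ord0 j ^+ 2)^-1 <= 1.
  have p := curv_term_gt0 j (x ord0 j) N0.
  rewrite invr_ge0 (ltW p) invf_le1//= lerDl mulr_ge0 ?sqr_ge0//.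
  by rewrite mulr_ge0// ltW// curv_gt0.
rewrite prodr_ge0; last by move=> j _; have /andP[] := h j.
rewrite /packet_weight -[leRHS](_ : \prod_(j < m.+1) 1 = 1); last by rewrite big1.
by apply: ler_prod => j _; exact: h.
Qed.

(** Only the first coordinate has nonzero frequency, hence a single damping factor; every spreading
    factor is bounded through [curv N j <= N^2]. *)
Lemma prod_heat_bound_le N u x : 1 <= N -> 0 <= u ->
  \prod_j heat_bound (freq N j) (curv N j) u (x ord0 j) <=
  expR (- (u * N ^+ 2 / (1 + 2 * u * N))) * (1 + 2 * u * N ^+ 2) ^+ m.+1 *
  packet_weight N x.
Proof.
move=> N1 u0; have N0 : 0 < N by exact: lt_le_trans N1.
pose d j : R := if j == ord0 then expR (- (u * N ^+ 2 / (1 + 2 * u * N))) else 1.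
have -> : expR (- (u * N ^+ 2 / (1 + 2 * u * N))) * (1 + 2 * u * N ^+ 2) ^+ m.+1 *
    packet_weight N x = \prod_j (d j * (1 + 2 * u * N ^+ 2) /
      (1 + 2 * curv N j * x ord0 j ^+ 2)).
  rewrite /packet_weight !big_split /= prodr_const card_ord; congr (_ * _ * _).
  by rewrite big_ord_recl big1 ?mulr1.
apply: ler_prod => j _; rewrite heat_bound_ge0 ?(ltW (curv_gt0 j N0))//=.
rewrite /heat_bound ler_wpM2r ?invr_ge0 ?(ltW (curv_term_gt0 _ _ N0))//.
rewrite ler_pM ?expR_ge0 ?addr_ge0 ?mulr_ge0 ?(ltW (curv_gt0 j N0))//.
  by rewrite /d /freq /curv; case: ifP => // _; rewrite expr0n/= mulr0 mul0r oppr0 expR0.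
by rewrite lerD2l ler_wpM2l ?mulr_ge0// curv_le.
Qed.

Lemma cintegrable_real (g : R -> R) : mu.-integrable setT (EFin \o g) ->
  cintegrable mu (fun v => (g v)%:C)%C.
Proof. by move=> ig; split; [exact: ig|exact: (integrable0 mu setT)]. Qed.

Lemma cint_real (g : R -> R) :
  cint mu (fun v => (g v)%:C)%C = ((Rintegral mu setT g)%:C)%C.
Proof. by apply: complex_ext => //=; rewrite Rintegral_cst// mul0r. Qed.

(** A sum of nonnegative bounds, so that one constant covers every moment of degree at most 2 k. *)
Definition tensor_const k : R := 2 * Num.sqrt pi * \sum_(i < (2 * k).+1) moment_bound i.

Lemma moment_bound_ge0 i : 0 <= moment_bound i :> R.
Proof.
apply: sumr_ge0 => l _; rewrite mulr_ge0 ?mulrn_wge0 ?exprn_ge0//.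
by rewrite mulr_ge0// osc_bound_ge0.
Qed.

Lemma tensor_const_ge0 k : 0 <= tensor_const k.
Proof.
by rewrite !mulr_ge0 ?sqrtr_ge0// sumr_ge0// => i _; exact: moment_bound_ge0.
Qed.

Definition heat_packet N x u xi : R[i] :=
  \prod_j (expi (x ord0 j * xi ord0 j) *
    ((expR (- (u * xi ord0 j ^+ 2)) * packet_hat (freq N j) (curv N j) (xi ord0 j))%:C)%C).

Lemma cint_heat_packet N x u k : 1 <= N -> 0 <= u ->
  cintegrable (lebesgue_row R m.+1)
    (fun xi => ((japanese xi ^+ k)%:C)%C * heat_packet N x u xi) /\
  normc (cint (lebesgue_row R m.+1)
    (fun xi => ((japanese xi ^+ k)%:C)%C * heat_packet N x u xi)) <=
  m.+2%:R ^+ k * tensor_const k ^+ m.+1 * N ^+ (2 * k) *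
    (expR (- (u * N ^+ 2 / (1 + 2 * u * N))) * (1 + 2 * u * N ^+ 2) ^+ m.+1 *
     packet_weight N x).
Proof.
move=> N1 u0; have N0 : 0 < N by exact: lt_le_trans N1.
pose h j (xi : R) := expi (x ord0 j * xi) *
  ((expR (- (u * xi ^+ 2)) * packet_hat (freq N j) (curv N j) xi)%:C)%C.
pose B j := heat_bound (freq N j) (curv N j) u (x ord0 j).
have B0 j : 0 <= B j by rewrite heat_bound_ge0// ltW// curv_gt0.
have H j i : (i <= 2 * k)%N ->
    cintegrable mu (fun xi : R => ((xi ^+ i)%:C)%C * h j xi) /\
    normc (cint mu (fun xi : R => ((xi ^+ i)%:C)%C * h j xi)) <= tensor_const k * N ^+ i * B j.
  move=> ik; have [h1 h2] := cint_packet_heat i (x ord0 j) (curv_gt0 j N0)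
    (curv_le j N1) (freq_itv j N1) N1 u0.
  split => //; apply: (le_trans h2); apply: ler_wpM2r; first exact: B0.
  apply: ler_wpM2r; first by rewrite exprn_ge0 ?(ltW N0).
  rewrite /tensor_const; apply: ler_wpM2l; first by rewrite mulr_ge0 ?sqrtr_ge0.
  have ik' : (i < (2 * k).+1)%N by rewrite ltnS.
  rewrite (bigD1 (Ordinal ik'))//= lerDl.
  by apply: sumr_ge0 => l _; exact: moment_bound_ge0.
have [i1 n1] := cint_japanese_tensor N1 (tensor_const_ge0 k) B0 H (e := fun=> 0%N)
  (fun j => leqnn (0 + 2 * k)).
have E : (fun xi : 'rV[R]_m.+1 => ((japanese xi ^+ k)%:C)%C *
    \prod_j (((xi ord0 j ^+ 0)%:C)%C * h j (xi ord0 j))) =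
    (fun xi => ((japanese xi ^+ k)%:C)%C * heat_packet N x u xi).
  apply/funext => xi; congr (_ * _); apply: eq_bigr => j _.
  by rewrite expr0 mul1r.
rewrite E in i1 n1; split => //; apply: (le_trans n1).
rewrite big1// addn0 ler_wpM2l ?prod_heat_bound_le//.
by rewrite !mulr_ge0 ?exprn_ge0 ?tensor_const_ge0 ?(ltW N0).
Qed.

Lemma measurable_row_packet_hat N : measurable_fun setT (@row_packet_hat R m N).
Proof.
have [i1 _] := cint_tensor (fun j => (cintegrable0 mu)).
apply: measurable_prod => j _.
apply: (measurableT_comp _ (measurable_row_coord j)).
apply: measurable_funM; first exact: measurable_cst.
apply: measurableT_comp => //; apply: measurableT_comp => //.
apply: measurable_funM; last exact: measurable_cst.
by apply: measurable_funX; apply: measurable_funB => //; exact: measurable_cst.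
Qed.

Definition bessel_const s k : R := let a := k%:R - s / 2 in
  (2 * pi) ^- m.+1 * ((gamma_const a)^-1 *
    (2 * (m.+2%:R ^+ k * tensor_const k ^+ m.+1 * damped_const a m.+1))).

(** With a = k - s / 2, the symbol J^(s/2) is J^k J^(-a), and Gamma(a) J^(-a) is the integral of
    [gamma_kernel]. The factor J^k costs N^(2 k), the integral over heat times gains N^(-2 a), and 2
    k - 2 a = s. *)
Lemma normc_bessel_row_packet_le N s x k : 1 <= N -> 1 <= k%:R - s / 2 ->
  normc (bessel s (row_packet N) x) <= bessel_const s k * N `^ s * packet_weight N x.
Proof.
move=> N1; set a := k%:R - s / 2 => a1; have N0 : 0 < N by exact: lt_le_trans N1.
pose row := lebesgue_row R m.+1.
pose J (xi : 'rV[R]_m.+1) := japanese xi.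
have J0 xi : 0 < J xi by exact: lt_le_trans (japanese_ge1 xi).
pose P xi := J xi ^+ k * row_packet_hat N xi.
pose H (z : measurableTypeR R * 'rV[R]_m.+1) : R[i] := expi (dot x z.2) *
  ((gamma_kernel a (J z.2) z.1 * P z.2)%:C)%C.
have hat_heat u xi : heat_packet N x u xi = expi (dot x xi) *
    ((expR (- (u * (J xi - 1))) * row_packet_hat N xi)%:C)%C.
  rewrite /heat_packet big_split /= -expi_sum; congr (_ * _).
  rewrite -real_complex_prod; congr (_%:C)%C; rewrite big_split /=; congr (_ * _).
  by rewrite -expR_sum sumrN -mulr_sumr /J /japanese [1 + _]addrC addrK.
(* Splitting exp(-u J) into exp(-u) exp(-u |xi|^2) turns the kernel into [gamma_fun] times a heat
   factor that is a product over the coordinates. *)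
have HE v xi : H (v, xi) = ((gamma_fun a v)%:C)%C *
    (((japanese xi ^+ k)%:C)%C * heat_packet N x (expR v) xi).
  rewrite hat_heat /H /=.
  transitivity (expi (dot x xi) * (((gamma_fun a v)%:C)%C * (((japanese xi ^+ k)%:C)%C *
    ((expR (- (expR v * (J xi - 1))) * row_packet_hat N xi)%:C)%C))); last by ring.
  congr (_ * _); rewrite -!real_complexM; congr (_%:C)%C; rewrite /P /gamma_kernel /gamma_fun.
  have -> : - (expR v * J xi) = - expR v + - (expR v * (J xi - 1)) by ring.
  by rewrite expRD; ring.
have iv v : cintegrable row (fun xi => H (v, xi)).
  under [X in cintegrable _ X]eq_fun do rewrite HE.
  by apply: cintegrableZ; exact: (cint_heat_packet x k N1 (expR_ge0 v)).1.
have ik xi : mu.-integrable setT (EFin \o gamma_kernel a (J xi)).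
  exact: (Rintegral_gamma_kernel a1 (J0 xi)).1.
have HE2 xi : (fun v => H (v, xi)) = (fun v => (expi (dot x xi) * ((P xi)%:C)%C) *
    ((gamma_kernel a (J xi) v)%:C)%C).
  by apply/funext => v; rewrite /H /= real_complexM; ring.
have ixi xi : cintegrable mu (fun v => H (v, xi)).
  by rewrite HE2; exact/cintegrableZ/cintegrable_real.
have P0 xi : 0 <= P xi.
  rewrite mulr_ge0 ?exprn_ge0 ?(ltW (J0 xi))// prodr_ge0// => j _.
  by rewrite mulr_ge0 ?sqrtr_ge0 ?expR_ge0.
(* The heat packet at x = 0 and u = 0, weighted by J^k, is P itself. *)
have iP : row.-integrable setT (EFin \o P).
  have [[i1 _] _] := cint_heat_packet 0 k N1 (lexx 0).
  have PE : (fun xi : 'rV[R]_m.+1 => complex.Re (((japanese xi ^+ k)%:C)%C * heat_packet N 0 0 xi)) = P.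
    apply/funext => xi; rewrite /heat_packet.
    under eq_bigr do rewrite mxE mul0r expi0 mul1r mul0r oppr0 expR0 mul1r.
    by rewrite -real_complex_prod -real_complexM.
  by move: i1; rewrite PE.
have mJ : measurable_fun [set: measurableTypeR R * 'rV[R]_m.+1] (fun z => J z.2).
  exact: (measurableT_comp (@measurable_japanese R m.+1) measurable_snd).
have mH : cmeasurable H.
  apply: cmeasurableM.
    apply: cmeasurable_expi.
    apply: (measurableT_comp (_ : measurable_fun setT (dot x)) measurable_snd).
    apply: measurable_sum => j; apply: measurable_funM; first exact: measurable_cst.
    exact: (measurable_row_coord j).
  apply: cmeasurable_real; apply: measurable_funM.
    apply: measurable_funM.
      by apply: measurableT_comp => //; apply: measurable_funM => //; exact: measurable_cst.
    apply: measurableT_comp => //; apply: measurableT_comp => //.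
    by apply: measurable_funM => //; apply: measurableT_comp.
  apply: measurable_funM; first exact: measurable_funX.
  exact: (measurableT_comp (measurable_row_packet_hat N) measurable_snd).
(* J >= 1 gives a majorant with separated variables, which makes H integrable on the product and
   justifies Fubini. *)
have nH v xi : normc (H (v, xi)) <= gamma_fun a v * P xi.
  rewrite (_ : H (v, xi) =
    expi (dot x xi) * ((gamma_kernel a (J xi) v * P xi)%:C)%C)//.
  rewrite normcM normc_expi mul1r normc_real.
  rewrite ger0_norm; last by rewrite mulr_ge0// mulr_ge0 ?expR_ge0.
  apply: ler_wpM2r => //; apply: ler_wpM2l; first exact: expR_ge0.
  rewrite ler_expR lerN2 ler_peMr ?expR_ge0//.
  exact: japanese_ge1.
have iH : cintegrable (mu \x row)%E H.
  apply: (cintegrable_le mH _ (integrable_prodM (integrable_gamma_fun a1) iP)).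
  by move=> [v xi]; exact: nH.
have bE : bessel s (row_packet N) x = (((2 * pi) ^- m.+1)%:C)%C *
    ((((gamma_const a)^-1)%:C)%C * cint mu (fun v => cint row (fun xi => H (v, xi)))).
  rewrite (cint_swap iH iv ixi) /bessel /inv_fourier; congr (_ * _).
  have iX : cintegrable row (fun xi => cint mu (fun v => H (v, xi))).
    pose H' (z : 'rV[R]_m.+1 * measurableTypeR R) := H (z.2, z.1).
    have mH' : cmeasurable H'.
      have [m1 m2] := mH; split.
        exact: (measurableT_comp m1 (@measurable_swap _ _ _ _)).
      exact: (measurableT_comp m2 (@measurable_swap _ _ _ _)).
    have iH' : cintegrable (row \x mu)%E H'.
      apply: (cintegrable_le mH' _ (integrable_prodM iP (integrable_gamma_fun a1))).
      by move=> [xi v]; rewrite mulrC; exact: nH.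
    exact: (cintegrable_fst iH' ixi).
  rewrite -cintZ//; apply: eq_cint => xi.
  rewrite HE2 cintZ ?cint_real; last exact/cintegrable_real.
  rewrite (Rintegral_gamma_kernel a1 (J0 xi)).2 fourier_row_packet// enorm_sqr -/(J xi).
  transitivity (expi (dot x xi) * ((((gamma_const a)^-1)%:C)%C *
    (((P xi)%:C)%C * ((gamma_const a * J xi `^ (- a))%:C)%C))); last by ring.
  congr (_ * _); rewrite -!real_complexM; congr (_%:C)%C.
  have g0 := gamma_const_gt0 a1.
  have -> : J xi `^ (s / 2) = J xi ^+ k * J xi `^ (- a).
    rewrite -powR_mulrn ?(ltW (J0 xi))// -powRD; last by rewrite (gt_eqF (J0 xi)) implybT.
    by congr (_ `^ _); rewrite /a; ring.
  by rewrite /P; field; rewrite gt_eqF.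
have nv v : normc (cint row (fun xi => H (v, xi))) <=
    m.+2%:R ^+ k * tensor_const k ^+ m.+1 * N ^+ (2 * k) * packet_weight N x *
    damped_fun a m.+1 N v.
  have [i1 n1] := cint_heat_packet x k N1 (expR_ge0 v).
  under eq_cint do rewrite HE.
  rewrite cintZ// normcM normc_real ger0_norm; last by rewrite mulr_ge0 ?expR_ge0.
  apply: (le_trans (ler_wpM2l _ n1)); first by rewrite mulr_ge0 ?expR_ge0.
  rewrite /damped_fun le_eqVlt; apply/orP; left; apply/eqP; ring.
have [id nd] := Rintegral_damped_fun_le m.+1 a1 N1.
have iC : cintegrable mu (fun v => cint row (fun xi => H (v, xi))).
  exact: (cintegrable_fst iH iv).
have pw := packet_weight_itv x N0.
rewrite bE !normcM !normc_real.
rewrite ger0_norm; last by rewrite invr_ge0 exprn_ge0// mulr_ge0 ?pi_ge0.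
rewrite ger0_norm; last by rewrite invr_ge0 ltW// gamma_const_gt0.
rewrite /bessel_const -/a; move: (damped_const a m.+1) nd => dc nd.
rewrite -!mulrA ler_wpM2l ?invr_ge0 ?exprn_ge0 ?mulr_ge0 ?pi_ge0//.
rewrite ler_wpM2l ?invr_ge0 ?(ltW (gamma_const_gt0 a1))//.
apply: (le_trans (normc_cint_le iC (integrable_mull _ id) nv)).
rewrite ler_wpM2l// (RintegralZl _ measurableT id).
apply: (le_trans (ler_wpM2l _ nd)).
  by rewrite !mulr_ge0 ?exprn_ge0 ?tensor_const_ge0 ?(ltW N0)//; have /andP[] := pw.
have -> : N `^ s = N ^+ (2 * k) * N `^ (- (2 * a)).
  rewrite -powR_mulrn ?(ltW N0)// -powRD; last by rewrite (gt_eqF N0) implybT.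
  by congr (_ `^ _); rewrite /a natrM; field.
by rewrite le_eqVlt; apply/orP; left; apply/eqP; ring.
Qed.

End packet_bounds.

(** * Schwartz functions as products of one-variable factors *)

Section schwartz_tensors.
Context {R : realType} (n : nat).

Lemma is_derive_line (f : 'rV[R]_n -> R) (x v : 'rV[R]_n) (df : R) :
  is_derive (0 : R) 1 (fun h => f (h *: v + x)) df -> is_derive x v f df.
Proof.
move=> [d1 d2].
have E : (fun h : R => h^-1 *: ((f \o shift x) (h *: v) - f x)) =
    (fun h : R => h^-1 *: (((fun h => f (h *: v + x)) \o shift 0) (h *: 1) -
      (fun h => f (h *: v + x)) 0)).
  by apply/funext => h /=; rewrite scale0r add0r addr0 /GRing.scale/= mulr1.
apply: DeriveDef; first by rewrite /derivable E.
by rewrite /derive E.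
Qed.

Definition row_tensor (u : 'I_n -> R -> R) (x : 'rV[R]_n) : R :=
  \prod_j u j (x ord0 j).

Lemma continuous_row_tensor (u : 'I_n -> R -> R) :
  (forall j, continuous (u j)) -> continuous (row_tensor u).
Proof.
move=> cu; rewrite /row_tensor; elim: (index_enum _) => [|j s IHs].
  have -> : (fun x : 'rV[R]_n => \prod_(j <- [::]) u j (x ord0 j)) = cst 1.
    by apply/funext => x; rewrite big_nil.
  exact: cst_continuous.
under eq_fun do rewrite big_cons.
move=> x; apply: continuousM; last exact: IHs.
apply: (@continuous_comp _ _ _ (fun x : 'rV[R]_n => x ord0 j) (u j)).
  exact: coord_continuous.
exact: cu.
Qed.

Lemma is_derive_row_tensor (u : 'I_n -> R -> R) (i : 'I_n) (du : R -> R)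
    (x : 'rV[R]_n) : (forall z : R, is_derive z 1 (u i) (du z)) ->
  is_derive x (delta_mx ord0 i) (row_tensor u)
    (row_tensor (fun j => if j == i then du else u j) x).
Proof.
move=> Du; apply: is_derive_line.
pose k := \prod_(j < n | j != i) u j (x ord0 j).
have Dl : is_derive (0 : R) 1 (fun h : R => h + x ord0 i) (1 + 0).
  by apply: is_derive1D.
have Dui : is_derive (0 + x ord0 i) 1 (u i) (du (x ord0 i)) by rewrite add0r.
have D1 := is_derive1Z k (@is_derive1_compose R (u i) (fun h : R => h + x ord0 i) 0
  (du (x ord0 i)) (1 + 0) Dui Dl).
apply: (is_derive1_eq D1).
  move=> h; rewrite /row_tensor (bigD1 i)//= !mxE !eqxx mulr1 mulrC; congr (_ * _).
  by apply: eq_bigr => j ji; rewrite !mxE eqxx /= (negbTE ji) mulr0 add0r.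
rewrite addr0 mulr1 mulrC /row_tensor (bigD1 i)//= eqxx; congr (_ * _).
by apply: eq_bigr => j /negbTE ->.
Qed.

(** A partial derivative of a tensor is a tensor with one factor differentiated. P j stands for a
    class of factors stable under differentiation, so no formula for higher derivatives is
    needed. *)
Lemma real_schwartz_row_tensor (P : 'I_n -> (R -> R) -> Prop) (u : 'I_n -> R -> R) :
  (forall j f, P j f -> exists2 df, P j df & forall z : R, is_derive z 1 f (df z)) ->
  (forall j f a, P j f -> exists M, forall z, `|z ^+ a * f z| <= M) ->
  (forall j, P j (u j)) -> real_schwartz (row_tensor u).
Proof.
move=> PD Pdecay Pu.
have Pc j f : P j f -> continuous f.
  by move=> /PD[df _ Df]; exact: is_derive_continuous Df.
have part b : exists2 w : 'I_n -> R -> R, (forall j, P j (w j)) &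
    partials b (row_tensor u) = row_tensor w.
  elim: b => [|i b [w Pw IH]]; first by exists u.
  have [df Pdf Df] := PD i (w i) (Pw i).
  exists (fun j => if j == i then df else w j).
    by move=> j; case: eqP => [->|_].
  rewrite /= -/(partials b (row_tensor u)) IH; apply/funext => x.
  by have [_ ->] := is_derive_row_tensor x Df.
split=> [b|a b].
  have [w Pw ->] := part b; split.
    by apply: continuous_row_tensor => j; exact: Pc (Pw j).
  move=> i x; have [df _ Df] := PD i (w i) (Pw i).
  by have [] := is_derive_row_tensor x Df.
have [w Pw ->] := part b.
have /choice[M HM] : forall j, exists M, forall z, `|z ^+ a j * w j z| <= M.
  by move=> j; exact: Pdecay (Pw j).
exists (\prod_j M j) => x; rewrite /row_tensor -big_split /= normr_prod.
by apply: ler_prod => j _; rewrite normr_ge0 HM.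
Qed.

End schwartz_tensors.

(** * The packets are Schwartz functions *)

Section packet_schwartz.
Context {R : realType}.
Implicit Types (a y z M L N : R).

(** The linear span of x^l cos(y x) e^(-x^2) and x^l sin(y x) e^(-x^2) at x = a z: it contains the
    real and imaginary parts of a packet and is stable under differentiation. *)
Inductive osc_class a y : (R -> R) -> Prop :=
| osc_class0 : osc_class a y (fun=> 0)
| osc_class_cos l : osc_class a y (fun z => osc_fun (@cos R) l y 0 (a * z))
| osc_class_sin l : osc_class a y (fun z => osc_fun (@sin R) l y 0 (a * z))
| osc_classD c f g : osc_class a y f -> osc_class a y g ->
    osc_class a y (fun z => c * f z + g z).

Lemma osc_class_derive a y f : osc_class a y f ->
  exists2 df, osc_class a y df & forall z : R, is_derive z 1 f (df z).
Proof.
elim=> [|l|l|c {}f g _ [df Cdf Df] _ [dg Cdg Dg]].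
- by exists (fun=> 0); [exact: osc_class0|move=> z; exact: is_derive_cst].
- exists (fun z => (a * l%:R) * osc_fun (@cos R) l.-1 y 0 (a * z) +
    ((- (a * y)) * osc_fun (@sin R) l y 0 (a * z) +
     ((- (2 * a)) * osc_fun (@cos R) l.+1 y 0 (a * z) + 0))).
    by do !apply: osc_classD; do ?[exact: osc_class_cos|exact: osc_class_sin|exact: osc_class0].
  move=> z; have D1 := is_derive1Z a (is_derive_id z 1).
  apply: (is_derive1_eq (is_derive1_compose
    (is_derive_osc_fun l y 0 (a * z) (@is_derive_cos R)) D1)) => //.
  by rewrite /osc_fun; ring.
- exists (fun z => (a * l%:R) * osc_fun (@sin R) l.-1 y 0 (a * z) +
    ((a * y) * osc_fun (@cos R) l y 0 (a * z) +
     ((- (2 * a)) * osc_fun (@sin R) l.+1 y 0 (a * z) + 0))).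
    by do !apply: osc_classD; do ?[exact: osc_class_cos|exact: osc_class_sin|exact: osc_class0].
  move=> z; have D1 := is_derive1Z a (is_derive_id z 1).
  apply: (is_derive1_eq (is_derive1_compose
    (is_derive_osc_fun l y 0 (a * z) (@is_derive_sin R)) D1)) => //.
  by rewrite /osc_fun; ring.
- exists (fun z => c * df z + dg z); first exact: osc_classD.
  by move=> z; apply: is_derive1D => //; exact: is_derive1Z.
Qed.

Lemma osc_class_decay a y f b : 0 < a -> osc_class a y f ->
  exists M, forall z, `|z ^+ b * f z| <= M.
Proof.
move=> a0.
have gen T l : (forall z : R, `|T z| <= 1) -> exists M, forall z,
    `|z ^+ b * osc_fun T l y 0 (a * z)| <= M.
  move=> T1; exists (a ^- b * pow_gauss_bound (b + l)) => z.
  have -> : z ^+ b * osc_fun T l y 0 (a * z) =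
      a ^- b * ((a * z) ^+ b * osc_fun T l y 0 (a * z)).
    by rewrite exprMn !mulrA mulVf ?mul1r// expf_neq0// gt_eqF.
  rewrite normrM ger0_norm ?invr_ge0 ?exprn_ge0 ?(ltW a0)//.
  apply: ler_wpM2l; first by rewrite invr_ge0 exprn_ge0// ltW.
  rewrite normrM normrX; set w := a * z.
  apply: (@le_trans _ _ (`|w| ^+ (b + l) * expR (- w ^+ 2))).
    rewrite exprD -mulrA; apply: ler_wpM2l; first exact: exprn_ge0.
    exact: norm_osc_fun_le.
  apply: (le_trans (pow_gauss_le _ _)).
  rewrite ler_piMr ?pow_gauss_bound_ge0// -[leRHS]expR0 ler_expR oppr_le0.
  by rewrite divr_ge0// sqr_ge0.
elim=> [|l|l|c {}f g _ [M1 H1] _ [M2 H2]].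
- by exists 0 => z; rewrite mulr0 normr0.
- exact/gen/cos_max.
- exact/gen/sin_max.
- exists (`|c| * M1 + M2) => z.
  have -> : z ^+ b * (c * f z + g z) = c * (z ^+ b * f z) + z ^+ b * g z by ring.
  apply: (le_trans (ler_normD _ _)); apply: lerD => //.
  by rewrite normrM; apply: ler_wpM2l.
Qed.

Lemma Re_packet M L z : 0 < L -> complex.Re (packet M L z) =
  osc_fun (@cos R) 0 (M / Num.sqrt (L / 2)) 0 (Num.sqrt (L / 2) * z).
Proof.
move=> L0; have a0 : 0 < Num.sqrt (L / 2) by rewrite sqrtr_gt0 divr_gt0.
rewrite /packet ReM /= mulr0 subr0 /osc_fun expr0 mul1r mul0r subr0.
by rewrite [M / _ * _]mulrA divfK ?gt_eqF// exprMn sqr_sqrtr// divr_ge0// ltW.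
Qed.

Lemma Im_packet M L z : 0 < L -> complex.Im (packet M L z) =
  osc_fun (@sin R) 0 (M / Num.sqrt (L / 2)) 0 (Num.sqrt (L / 2) * z).
Proof.
move=> L0; have a0 : 0 < Num.sqrt (L / 2) by rewrite sqrtr_gt0 divr_gt0.
rewrite /packet ImM /= mulr0 add0r /osc_fun expr0 mul1r mul0r subr0.
by rewrite [M / _ * _]mulrA divfK ?gt_eqF// exprMn sqr_sqrtr// divr_ge0// ltW.
Qed.

Lemma Re_mul_real (z : R[i]) (r : R) : complex.Re (z * (r%:C)%C) = complex.Re z * r.
Proof. by case: z => u v; rewrite ReM /= mulr0 subr0. Qed.

Lemma Im_mul_real (z : R[i]) (r : R) : complex.Im (z * (r%:C)%C) = complex.Im z * r.
Proof. by case: z => u v; rewrite ImM /= mulr0 add0r. Qed.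

Lemma schwartz_row_packet (m : nat) N : 1 <= N -> schwartz (@row_packet R m N).
Proof.
move=> N1; have N0 : 0 < N by exact: lt_le_trans N1.
pose a (j : 'I_m.+1) := Num.sqrt (curv N j / 2).
have a0 j : 0 < a j by rewrite sqrtr_gt0 divr_gt0// curv_gt0.
pose P j := osc_class (a j) (freq N j / a j).
pose g j z := osc_fun (@cos R) 0 (freq N j / a j) 0 (a j * z).
(* All factors but the first have frequency 0 and are real, so the real and imaginary parts of the
   whole product are again tensors. *)
have packet_real j z : j != ord0 ->
    packet (freq N j) (curv N j) z = ((g j z)%:C)%C.
  move=> j0; apply: complex_ext; first by rewrite Re_packet// curv_gt0.
  rewrite Im_packet ?curv_gt0// /freq (negbTE j0) /osc_fun.
  by rewrite !mul0r subr0 sin0 mulr0 mul0r.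
have packetE (x : 'rV[R]_m.+1) : row_packet N x = 
    packet (freq N (ord0 : 'I_m.+1)) (curv N (ord0 : 'I_m.+1)) (x ord0 ord0) *
    ((\prod_(j < m) g (lift ord0 j) (x ord0 (lift ord0 j)))%:C)%C.
  rewrite /row_packet big_ord_recl; congr (_ * _); rewrite real_complex_prod.
  by apply: eq_bigr => j _; exact: packet_real.
have PD j f : P j f -> exists2 df, P j df & forall z : R, is_derive z 1 f (df z).
  exact: osc_class_derive.
have Pd j f b : P j f -> exists M, forall z, `|z ^+ b * f z| <= M.
  exact: osc_class_decay.
split.
  have -> : (fun x => complex.Re (row_packet N x)) = row_tensor g.
    apply/funext => x; rewrite packetE Re_mul_real Re_packet ?curv_gt0//.
    by rewrite /row_tensor big_ord_recl.
  by apply: (real_schwartz_row_tensor PD Pd) => j; exact: osc_class_cos.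
pose h j z := if j == ord0 then osc_fun (@sin R) 0 (freq N j / a j) 0 (a j * z) else g j z.
have -> : (fun x => complex.Im (row_packet N x)) = row_tensor h.
  apply/funext => x; rewrite packetE Im_mul_real Im_packet ?curv_gt0//.
  by rewrite /row_tensor big_ord_recl.
apply: (real_schwartz_row_tensor PD Pd) => j; rewrite /h; case: eqP => _.
  exact: osc_class_sin.
exact: osc_class_cos.
Qed.

End packet_schwartz.

(** * Norms of the packets and failure of the estimate *)

Section packet_norms.
Context {R : realType} (m : nat).
Implicit Types (N p q s : R).

(** The packet occupies a volume N^(-1/2) N^(-m), that is N to the power minus [packet_rate]. *)
Definition packet_rate : R := (m.*2.+1)%:R / 2.

Definition packet_mass : R :=
  ((Num.sqrt 2)^-1 * \int[lebesgue_measure]_x (1 + x ^+ 2)^-1) ^+ m.+1.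

Lemma packet_mass_ge0 : 0 <= packet_mass.
Proof.
rewrite exprn_ge0// mulr_ge0 ?invr_ge0// Rintegral_ge0// => x _.
by rewrite invr_ge0 addr_ge0// sqr_ge0.
Qed.

Lemma powR_expr N k : 0 < N -> N `^ (k%:R / 2) = Num.sqrt N ^+ k.
Proof.
move=> N0; rewrite mulrC powRrM powR12_sqrt ?(ltW N0)// powR_mulrn//.
Qed.

Lemma Rintegral_packet_weight N : 0 < N ->
  (lebesgue_row R m.+1).-integrable setT (EFin \o packet_weight N) /\
  \int[lebesgue_row R m.+1]_x packet_weight N x = packet_mass * N `^ (- packet_rate).
Proof.
move=> N0; pose J := \int[lebesgue_measure]_x ((1 + x ^+ 2)^-1 : R).
pose a (j : 'I_m.+1) := Num.sqrt (2 * curv N j).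
have a0 j : 0 < a j by rewrite sqrtr_gt0 mulr_gt0// curv_gt0.
pose F (j : 'I_m.+1) (z : R) := (1 + 2 * curv N j * z ^+ 2)^-1.
have FE j : F j = (fun z => (1 + (a j * z + 0) ^+ 2)^-1).
  apply/funext => z; rewrite /F addr0 exprMn sqr_sqrtr// mulr_ge0// ltW// curv_gt0//.
have iF j : lebesgue_measure.-integrable setT (EFin \o F j).
  by rewrite FE; exact: (integrable_affine 0 (a0 j) continuous_cauchy integrable_cauchy).
have FI j : \int[lebesgue_measure]_x F j x = (a j)^-1 * J.
  rewrite /J (Rintegral_affine 0 (a0 j) continuous_cauchy integrable_cauchy).
  by rewrite -FE mulKf// gt_eqF.
have [iw ->] := Rintegral_tensor iF; split; first exact: iw.
under eq_bigr do rewrite FI.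
have aE j : (a j)^-1 * J = ((Num.sqrt 2)^-1 * J) * (Num.sqrt (curv N j))^-1.
  by rewrite /a sqrtrM// invfM mulrAC.
under eq_bigr do rewrite aE.
rewrite big_split /= prodr_const card_ord; congr (_ * _).
rewrite powRN /packet_rate powR_expr// prodfV; congr (_^-1).
rewrite big_ord_recl (eq_bigr (fun=> Num.sqrt N ^+ 2)).
  by rewrite prodr_const card_ord -exprM -exprS mul2n.
by move=> j _; rewrite /curv /= sqr_sqrtr ?(ltW N0)// sqrtr_sqr gtr0_norm.
Qed.

Lemma sobolev_norm_row_packet_le p s : 1 <= p -> exists2 A : R, 0 <= A &
  forall N, 1 <= N -> (sobolev_norm p s (@row_packet R m N) <=
    (A * N `^ (s - packet_rate / p))%:E)%E.
Proof.
move=> p1; have p0 : 0 < p by exact: lt_le_trans p1.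
have [k hk] := exists_nat_ge (1 + s / 2).
have {}hk : 1 <= k%:R - s / 2 by rewrite lerBrDr.
pose B := `|@bessel_const R m s k|.
exists (B * packet_mass `^ p^-1).
  by rewrite mulr_ge0// ?normr_ge0// powR_ge0.
move=> N N1; have N0 : 0 < N by exact: lt_le_trans N1.
have [iw Iw] := Rintegral_packet_weight N0.
pose c := (B * N `^ s) `^ p.
have c0 : 0 <= c by exact: powR_ge0.
have bound (x : 'rV[R]_m.+1) :
    (`|(normc (bessel s (row_packet N) x))%:E| `^ p <= (c * packet_weight N x)%:E)%E.
  have /andP[w0 w1] := packet_weight_itv x N0.
  rewrite abse_EFin poweR_EFin lee_fin (ger0_norm (normc_ge0 _)).
  apply: (@le_trans _ _ ((B * N `^ s * packet_weight N x) `^ p)).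
    apply: ge0_ler_powR; rewrite ?nnegrE ?(ltW p0) ?normc_ge0//.
      by rewrite !mulr_ge0// ?normr_ge0// powR_ge0.
    apply: (le_trans (normc_bessel_row_packet_le x N1 hk)).
    do 2 (apply: ler_wpM2r; rewrite ?powR_ge0//); exact: ler_norm.
  rewrite powRM ?mulr_ge0 ?normr_ge0 ?powR_ge0// ler_wpM2l//.
  (* A weight in [0, 1] dominates its p-th power as p >= 1, so the L^p norm reduces to the integral
     of the weight; [ger_powR] is applied to a positive base, hence the split. *)
  have [->|wn0] := eqVneq (packet_weight N x) 0; first by rewrite powR0// gt_eqF.
  rewrite -[leRHS]powRr1//; apply: ger_powR => //; first by rewrite lt0r wn0 w0 w1.
rewrite /sobolev_norm unlock.
apply: (@le_trans _ _ (((c * (packet_mass * N `^ (- packet_rate)))%:E) `^ p^-1)%E).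
  apply: gt0_ler_poweR; rewrite ?invr_ge0 ?(ltW p0)//.
  - by rewrite in_itv /= leey andbT integral_ge0// => x _; exact: poweR_ge0.
  - by rewrite in_itv /= leey andbT lee_fin mulr_ge0// mulr_ge0 ?packet_mass_ge0 ?powR_ge0.
  apply: (le_trans (ge0_le_integralT _ _ bound)); first by move=> x; exact: poweR_ge0.
  under eq_integral do rewrite EFinM.
  rewrite integralZl// EFinM lee_wpmul2l ?lee_fin//.
  by rewrite -Iw /Rintegral fineK//; exact: integrable_fin_num.
rewrite poweR_EFin lee_fin /c.
have M0 := packet_mass_ge0.
rewrite !powRM ?mulr_ge0 ?normr_ge0 ?powR_ge0//.
rewrite -!powRrM mulfV ?gt_eqF// powRr1 ?normr_ge0// mulNr.
by rewrite mulr1 mulrACA -powRD ?(gt_eqF N0) ?implybT.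
Qed.

Lemma weak_Lnorm_row_packet_ge q : 1 <= q -> exists2 B : R, 0 < B &
  forall N, 1 <= N -> ((B * N `^ (- (m%:R / 2)))%:E <=
    weak_Lnorm q unit_ball (schrodinger_maximal (@row_packet R m N)))%E.
Proof.
move=> q1; have q0 : 0 < q by exact: lt_le_trans q1.
have l0 := @lower_const_gt0 R m; have v0 := @box_volume_gt0 R m.
exists (lower_const m / 2 * (box_volume m) `^ q^-1).
  by rewrite mulr_gt0 ?divr_gt0// powR_gt0.
move=> N N1; have N0 : 0 < N by exact: lt_le_trans N1.
(* Half of the pointwise lower bound, since the super-level set is defined by a strict inequality;
   the whole box, of volume independent of N, then lies in it. *)
pose a : R := lower_const m / 2 * N `^ (- (m%:R / 2)).
have a0 : 0 < a by rewrite mulr_gt0 ?divr_gt0// powR_gt0.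
apply: (@le_trans _ _ (a%:E * lebesgue_row R m.+1 [set x | unit_ball x /\
    a%:E < `|schrodinger_maximal (row_packet N) x|] `^ q^-1)%E); last first.
  by apply: ereal_sup_ubound; exists a.
rewrite mulrAC EFinM -/a lee_wpmul2l ?lee_fin ?(ltW a0)// -poweR_EFin.
rewrite -lebesgue_row_packet_box.
apply: gt0_ler_poweR; rewrite ?invr_ge0 ?(ltW q0)// ?in_itv /= ?leey ?measure_ge0//.
apply: le_lebesgue_row => x bx; split; first exact: packet_box_unit_ball.
have [t t01 Hx] := schrodinger_row_packet_ge N1 bx.
apply: (@lt_le_trans _ _ (normc (schrodinger t (row_packet N) x))%:E).
  rewrite lte_fin; apply: lt_le_trans Hx.
  rewrite /a powRN powR_expr// ltr_pM2r ?invr_gt0 ?exprn_gt0 ?sqrtr_gt0//.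
  by rewrite ltr_pdivrMr// ltr_pMr// ltr1n.
apply: (le_trans _ (lee_abs _)).
by apply: ereal_sup_ubound; exists t.
Qed.

Lemma no_packet_bound p q s : 1 <= p -> 1 <= q ->
  s < packet_rate / p - m%:R / 2 ->
  ~ exists C : R, forall f : 'rV[R]_m.+1 -> R[i], schwartz f ->
      (weak_Lnorm q unit_ball (schrodinger_maximal f)
        <= C%:E * sobolev_norm p s f)%E.
Proof.
move=> p1 q1 hs [C HC].
have [A A0 HA] := sobolev_norm_row_packet_le s p1.
have [B B0 HB] := weak_Lnorm_row_packet_ge q1.
pose d := packet_rate / p - m%:R / 2 - s.
have d0 : 0 < d by rewrite subr_gt0.
have key N : 1 <= N -> N `^ d <= `|C| * A / B.
  move=> N1; have N0 : 0 < N by exact: lt_le_trans N1.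
  have : ((B * N `^ (- (m%:R / 2)))%:E <= (`|C| * (A * N `^ (s - packet_rate / p)))%:E)%E.
    apply: (le_trans (HB N N1)); apply: (le_trans (HC _ (schwartz_row_packet m N1))).
    have S0 : (0 <= sobolev_norm p s (@row_packet R m N))%E by exact: Lnorm_ge0.
    (* C may be negative, and the norm bound can only be multiplied by a nonnegative constant. *)
    apply: (@le_trans _ _ (`|C|%:E * sobolev_norm p s (@row_packet R m N))%E).
      by apply: lee_wpmul2r => //; rewrite lee_fin ler_norm.
    by rewrite EFinM lee_wpmul2l ?lee_fin// HA.
  rewrite lee_fin => H.
  rewrite ler_pdivlMr//.
  have -> : N `^ d = N `^ (- (m%:R / 2)) * N `^ (- (s - packet_rate / p)).
    rewrite -powRD ?(gt_eqF N0) ?implybT//.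
    have -> : d = - (m%:R / 2) + - (s - packet_rate / p) by rewrite /d; ring.
    by [].
  rewrite [N `^ (- (s - _))]powRN mulrAC ler_pdivrMr ?powR_gt0//.
  by rewrite -mulrA [_ * B]mulrC.
pose K := `|C| * A / B.
have K0 : 0 <= K by rewrite divr_ge0 ?mulr_ge0 ?normr_ge0// ltW.
(* This N has N^d = K + 1, contradicting the bound N^d <= K. *)
have N1 : 1 <= (K + 1) `^ d^-1.
  rewrite -[leLHS](congr1 (fun f => f d^-1) (powR1 R)); apply: ge0_ler_powR; rewrite ?nnegrE ?invr_ge0 ?(ltW d0)//.
    by rewrite addr_ge0.
  by rewrite lerDr.
have := key _ N1; rewrite -powRrM mulVf ?gt_eqF// powRr1 ?addr_ge0// -/K.
by rewrite gerDl ler10.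
Qed.

End packet_norms.

Theorem theorem1p7 (R : realType) (n : nat) (p q s : R) :
  (1 <= n)%N -> 1 <= p -> 1 <= q ->
  [\/ n = 1%N /\ s < 1 / (2 * p),
      [/\ (2 <= n)%N, p < 2 & s < n%:R * (1 / p - 1 / 2)] |
      [/\ (2 <= n)%N, 2 <= p, p < (2 * n%:R - 1) / (n%:R - 1) &
          s < (1 / 2 - n%:R) * (1 / 2 - 1 / p) + 1 / 4]] ->
  ~ exists C : R, forall f : 'rV[R]_n -> R[i], schwartz f ->
      (weak_Lnorm q unit_ball (schrodinger_maximal f)
        <= C%:E * sobolev_norm p s f)%E.
Proof.
case: n => // m _ p1 q1 H; apply: no_packet_bound => //.
have p0 : 0 < p by exact: lt_le_trans p1.
have -> : packet_rate m / p = (m%:R + 1 / 2) * p^-1 :> R.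
  by rewrite /packet_rate -addn1 -mul2n natrD natrM; field; rewrite gt_eqF.
(* With n = m + 1 the first and third thresholds equal (m + 1/2) / p - m / 2; the second lies below
   this value by (1 - 1/p) / 2. *)
case: H => [[m0 ss]|[_ _ ss]|[_ _ _ ss]].
- have -> : m = 0%N by case: m0.
  by move: ss; rewrite !div1r invfM; lra.
- have : p^-1 <= 1 by rewrite invf_le1.
  move: ss; rewrite -(natr1 m) !div1r; lra.
- by move: ss; rewrite -(natr1 m) !div1r; lra.
Qed.
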